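(* For every $p\in(0,1)$ there is a constant $K=K(p)$, depending only on $p$, such that if $G\sim G(n,p)$, then asymptotically almost surely (with probability tending to $1$ as $n\to\infty$) the following holds for every eigenvector $f$ of the adjacency matrix of $G$. The two largest weak nodal domains of $f$ cover all vertices of $G$ with the exception of at most $K$ vertices. The two largest strong nodal domains of $f$ cover all the vertices in $\{v\in V(G): f(v)\neq 0\}$ with the exception of at most $K$ vertices. In particular, in both cases, every eigenvector of $G$ has at most $O_p(1)$ (that is, at most a constant depending only on $p$) strong or weak nodal domains.
   Context: $G(n,p)$ is the random graph on $n$ vertices in which each edge is present independently with probability $p$. An eigenvector $f$ of (the adjacency matrix of) a graph $G=(V,E)$ is identified with a function $f:V\to\mathbb{R}$. For a graph $G=(V,E)$ and any $f:V\to\mathbb{R}$, a subset $D\subseteq V$ is a weak nodal domain of $f$ if it is a maximal subset of $V$ subject to the two conditions: (1) $D$ is connected in $G$, and (2) if $x,y\in D$ then $f(x)f(y)\ge 0$. It is a strong nodal domain if (2) is replaced by: (2') if $x,y\in D$ then $f(x)f(y)>0$. ''Largest'' refers to the number of vertices. *)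

(* Defs.v *)
From mathcomp Require Import all_boot all_order all_algebra.
From mathcomp Require Import all_classical all_reals all_analysis.

Set Implicit Arguments.
Unset Strict Implicit.
Unset Printing Implicit Defensive.

Import Order.TTheory GRing.Theory Num.Theory.
Import numFieldNormedType.Exports.

Local Open Scope ring_scope.

Section NodalDomains.
Context {R : realType} {T : finType}.
Implicit Types (e : rel T) (f : T -> R) (D : {set T}) (S : {set {set T}}).

(* The empty set counts as connected. It is never a nodal domain of a nonzero
   [f], since it is not maximal then. *)
Definition connected_in e D : bool :=
  [forall x in D, forall y in D, connect [rel u v in D | e u v] x y].

Definition weak_nodal_domain e f D : bool :=
  maxset (fun B : {set T} => connected_in e B &&
    [forall x in B, forall y in B, 0 <= f x * f y]) D.

Definition strong_nodal_domain e f D : bool :=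
  maxset (fun B : {set T} => connected_in e B &&
    [forall x in B, forall y in B, 0 < f x * f y]) D.

Definition weak_nodal_domains e f : {set {set T}} :=
  [set D | weak_nodal_domain e f D].

Definition strong_nodal_domains e f : {set {set T}} :=
  [set D | strong_nodal_domain e f D].

(* [S] consists of two largest members of [F], or is all of [F] if [F] has
   fewer than two members. When sizes are tied, several [S] qualify. *)
Definition two_largest (F S : {set {set T}}) : Prop :=
  [/\ S \subset F, #|S| = minn 2 #|F|
    & forall A B, A \in S -> B \in F :\: S -> (#|B| <= #|A|)%N].

End NodalDomains.

Definition adjacency_mx {R : realType} {n : nat} (e : rel 'I_n) : 'M[R]_n :=
  \matrix_(i, j) (e i j)%:R.

Definition eigenvector {R : realType} {n : nat} (A : 'M[R]_n) (f : 'cV[R]_n) :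
    Prop :=
  f != 0 /\ exists a : R, A *m f = a *: f.

Definition edge_slots (n : nat) : {set {set 'I_n}} :=
  [set s : {set 'I_n} | #|s| == 2%N].

(* A simple graph on ['I_n] is its edge set, a set of two-element subsets. *)
Definition sgraph (n : nat) : Type :=
  {E : {set {set 'I_n}} | E \subset edge_slots n}.

Definition adj {n : nat} (G : sgraph n) : rel 'I_n :=
  [rel x y | [set x; y] \in val G].

Definition gnp_mass {R : realType} {n : nat} (p : R) (G : sgraph n) : R :=
  \prod_(s in edge_slots n) (if s \in val G then p else 1 - p).

Definition gnp_prob {R : realType} {n : nat} (p : R) (P : sgraph n -> Prop) :
    R :=
  \sum_(G : sgraph n | `[< P G >]) gnp_mass p G.

Definition gnp_aas {R : realType} (p : R) (P : forall n, sgraph n -> Prop) :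
    Prop :=
  ((fun n => gnp_prob p (P n)) @ \oo --> (1 : R))%classic.

(* Main.v *)
Require Import Defs.
From mathcomp Require Import all_boot all_order all_algebra.
From mathcomp Require Import all_classical all_reals all_analysis.
From mathcomp Require Import ring lra zify.

Set Implicit Arguments.
Unset Strict Implicit.
Unset Printing Implicit Defensive.

Import Order.TTheory GRing.Theory Num.Theory.
Import numFieldNormedType.Exports.

Local Open Scope ring_scope.

(* Write the adjacency matrix as A = p(J - I) + M with M centred. Almost surely
   |M| <= C sqrt n (Hoeffding and an integer net), and an eigenvector f of
   eigenvalue lam satisfies M f = (lam + p) f - p s 1 with s = sum f.
   If |lam + p| > pn/2, then f is a multiple of 1 + g with |g| = O(1), so all but
   O(1) values have the same sign. Otherwise |lam + p| = O(sqrt n) and s = O(|f|).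
   If f were positive on fewer than gam * n vertices, its positive part, and since
   s is small also f, would have l1 norm much smaller than sqrt n |f|. Rounding f
   to a multiple of eta / sqrt n then gives one of at most exp(kap n / 2) integer
   vectors, each of which is sparse; for a fixed one the rows of M outside the
   support are independent, and the equation on these rows fails except with
   probability exp(- kap n). So both sign sets are empty up to O(1) vertices or
   linear in n.
   Finally, almost surely any K vertices have an edge to any disjoint set of
   eps * n vertices, so a sign set of linear size has a component missing fewer
   than K of its vertices. *)

(** * Expectation over G(n,p) *)

Section Expectation.
Import mathcomp.boot.finset.
Context {R : realType} (p : R) {n : nat}.
Local Notation slot := {set 'I_n}.
Implicit Types (F H : {set slot} -> R) (B : {set slot}) (s : slot).

(** Functions are taken on arbitrary sets of slots rather than on graphs, so that inserting or
    deleting a slot never leaves their domain. *)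
Definition gnp_expect F : R := \sum_(G : sgraph n) gnp_mass p G * F (val G).

(** The conditional expectation of [F] given the status of every slot except [s]. *)
Definition resample s F B : R := p * F (s |: B) + (1 - p) * F (B :\ s).

(** The head of the list is averaged first, so an induction on the list computes the innermost
    average first. *)
Fixpoint resamples (L : seq slot) F : {set slot} -> R :=
  if L is s :: L' then resamples L' (resample s F) else F.

Definition indep_of s F := forall B, F (s |: B) = F B /\ F (B :\ s) = F B.

Definition mass_off s B : R :=
  \prod_(s' in edge_slots n | s' != s) (if s' \in B then p else 1 - p).

(** Pair each edge set avoiding [s] with its union with [s]: the two masses share the factor
    [mass_off] and differ only by p against 1 - p. *)
Lemma gnp_expect_split s F : s \in edge_slots n ->
  gnp_expect F =
  \sum_(B : {set slot} | (B \subset edge_slots n) && (s \notin B))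
     mass_off s B * resample s F B.
Proof.
move=> sE; pose w B := \prod_(s' in edge_slots n) (if s' \in B then p else 1 - p).
have wE B : w B = (if s \in B then p else 1 - p) * mass_off s B.
  by rewrite /w (bigD1 s).
have -> : gnp_expect F = \sum_(B : {set slot} | B \subset edge_slots n) w B * F B.
  rewrite /gnp_expect.
  rewrite [RHS](reindex_omap (val : sgraph n -> _) insub) => [|B BE]; last by rewrite insubT.
  apply: eq_bigl => G; rewrite valK eqxx andbT.
  by have -> := valP G.
rewrite (bigID (fun B => s \in B)) /=.
rewrite (reindex_onto (fun B => s |: B) (fun B => B :\ s)) /=; last first.
  by move=> B /andP[_ sB]; rewrite setD1K.
rewrite [X in X + _](_ : _ = \sum_(B : {set slot} | (B \subset edge_slots n) && (s \notin B))
   w (s |: B) * F (s |: B)); last first.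
  apply: eq_bigl => B; rewrite setU11 andbT subUset sub1set sE /=.
  congr (_ && _); apply/eqP/idP => [<-|sB]; first by rewrite !inE eqxx.
  by rewrite setU1K.
rewrite -big_split /=; apply: eq_bigr => B /andP[BE sB].
have BD : B :\ s = B by apply/setDidPl; rewrite disjoint_sym disjoints1.
rewrite !wE setU11 (negPf sB) /resample BD.
have -> : mass_off s (s |: B) = mass_off s B.
  by apply: eq_bigr => s' /andP[_ /negPf ss']; rewrite !inE ss'.
by ring.
Qed.

(** The tower property: after the split it suffices that averaging over [s] twice is the same as
    averaging once. *)
Lemma gnp_expect_resample s F : s \in edge_slots n ->
  gnp_expect (resample s F) = gnp_expect F.
Proof.
move=> sE; rewrite !(gnp_expect_split _ sE); apply: eq_bigr => B _; congr (_ * _).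
rewrite /resample.
have -> : s |: (s |: B) = s |: B by apply/setP=> x; rewrite !inE; case: eqP.
have -> : (s |: B) :\ s = B :\ s by apply/setP=> x; rewrite !inE; case: eqP.
have -> : s |: (B :\ s) = s |: B by apply/setP=> x; rewrite !inE; case: eqP.
have -> : B :\ s :\ s = B :\ s by apply/setP=> x; rewrite !inE; case: eqP.
by ring.
Qed.

Lemma gnp_expect_resamples L F : {subset L <= edge_slots n} ->
  gnp_expect (resamples L F) = gnp_expect F.
Proof.
elim: L F => //= s L IH F LE.
by rewrite IH ?gnp_expect_resample ?LE ?mem_head// => x xL; rewrite LE// in_cons xL orbT.
Qed.

Lemma eq_resamples L F H : F =1 H -> resamples L F =1 resamples L H.
Proof.
elim: L F H => //= s L IH F H FH; apply: IH => B.
by rewrite /resample !FH.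
Qed.

(** A factor that does not see the averaged slots comes out of the conditional expectation. *)
Lemma resamplesMr L F H : (forall s, s \in L -> indep_of s H) ->
  resamples L (fun B => F B * H B) =1 fun B => resamples L F B * H B.
Proof.
elim: L F => //= s L IH F LH B.
rewrite -IH => [|s' s'L]; last by apply: LH; rewrite in_cons s'L orbT.
apply: eq_resamples => {}B; rewrite /resample.
have [-> ->] := LH s (mem_head _ _) B; ring.
Qed.

Lemma resamplesD L F H :
  resamples L (fun B => F B + H B) =1 fun B => resamples L F B + resamples L H B.
Proof.
elim: L F H => //= s L IH F H B.
by rewrite -IH; apply: eq_resamples => {}B; rewrite /resample; ring.
Qed.

Lemma resamplesZ L c F :
  resamples L (fun B => c * F B) =1 fun B => c * resamples L F B.
Proof.
elim: L F => //= s L IH F B.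
by rewrite -IH; apply: eq_resamples => {}B; rewrite /resample; ring.
Qed.

Lemma resamples_cst L c : resamples L (fun=> c) =1 fun=> c.
Proof.
elim: L => //= s L IH B.
by rewrite -[RHS](IH B); apply: eq_resamples => {}B; rewrite /resample; ring.
Qed.

Context (hp0 : 0 < p) (hp1 : p < 1).

Lemma le_resamples L F H : (forall B, F B <= H B) ->
  forall B, resamples L F B <= resamples L H B.
Proof.
elim: L F H => //= s L IH F H FH; apply: IH => B.
by rewrite /resample lerD// ler_pM2l// subr_gt0.
Qed.

Lemma gnp_mass_ge0 (G : sgraph n) : 0 <= gnp_mass p G.
Proof.
by apply: prodr_ge0 => s _; case: ifP; rewrite ?subr_ge0 ltW.
Qed.

Lemma le_gnp_expect F H : (forall B, F B <= H B) -> gnp_expect F <= gnp_expect H.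
Proof. by move=> FH; apply: ler_sum => G _; rewrite ler_wpM2l ?gnp_mass_ge0. Qed.

Lemma gnp_expectZ c F : gnp_expect (fun B => c * F B) = c * gnp_expect F.
Proof. by rewrite mulr_sumr; apply: eq_bigr => G _; ring. Qed.

Lemma gnp_expect_sum (I : finType) (P : pred I) (F : I -> {set slot} -> R) :
  gnp_expect (fun B => \sum_(i | P i) F i B) = \sum_(i | P i) gnp_expect (F i).
Proof.
by rewrite exchange_big /=; apply: eq_bigr => G _; rewrite mulr_sumr.
Qed.

Lemma gnp_expect1 : gnp_expect (fun=> 1) = 1.
Proof.
(* Expanding the product of the sums a + b gives one term for each set of slots. The weights 0 and 1
   outside [edge_slots] kill the sets that are not edge sets of graphs. *)
pose a s : R := if s \in edge_slots n then p else 0.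
pose b s : R := if s \in edge_slots n then 1 - p else 1.
have ab1 : \prod_(s : slot) (a s + b s) = 1.
  by apply: big1 => s _; rewrite /a /b; case: ifP => _; ring.
rewrite -[RHS]ab1 bigA_distr /gnp_expect (bigID (fun J : {set slot} => J \subset edge_slots n)) /=.
rewrite [X in _ + X]big1 ?addr0 => [|J /subsetPn[s sJ sE]]; last first.
  by rewrite (bigD1 s)//= sJ /a (negPf sE) mul0r.
rewrite [RHS](reindex_omap (val : sgraph n -> _) insub) => [|B BE]; last by rewrite insubT.
apply: eq_big => [G|G _]; first by rewrite valK eqxx andbT; have -> := valP G.
rewrite /= mulr1 [RHS](bigID (mem (edge_slots n))) /= [X in _ * X]big1 ?mulr1 => [|s sE].
  by apply: eq_bigr => s sE; rewrite /a /b sE.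
rewrite /a /b (negPf sE); case: ifP => // sG.
by rewrite (fintype.subsetP (valP G) _ sG) in sE.
Qed.

(** Independence in the form used throughout. Each factor is averaged over its own block of slots
    only, with a bound uniform in all other slots; the remaining factors do not see that block, so
    the blocks are averaged one after the other. *)
Lemma gnp_expect_blocks (I : eqType) (r : seq I) (h : I -> {set slot} -> R)
    (L : I -> seq slot) (c : I -> R) :
  uniq r -> (forall i B, i \in r -> 0 <= h i B) ->
  (forall i, i \in r -> {subset L i <= edge_slots n}) ->
  (forall i B, i \in r -> resamples (L i) (h i) B <= c i) ->
  (forall i j s, i \in r -> j \in r -> i != j -> s \in L i -> indep_of s (h j)) ->
  gnp_expect (fun B => \prod_(i <- r) h i B) <= \prod_(i <- r) c i.
Proof.
elim: r => [|i r IH] /=.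
  by rewrite big_nil => _ _ _ _ _; rewrite (_ : (fun B => _) = fun=> 1) ?gnp_expect1//; apply/funext => B; rewrite big_nil.
move=> /andP[ir ur] h0 LE hc hind.
have mr j : j \in r -> j \in i :: r by move=> jr; rewrite in_cons jr orbT.
rewrite big_cons -(gnp_expect_resamples _ (LE i (mem_head _ _))).
have c0 : 0 <= c i.
  apply: le_trans (hc i set0 (mem_head _ _)).
  by rewrite -(resamples_cst (L i) 0 set0) le_resamples// => B; rewrite h0// mem_head.
apply: (@le_trans _ _ (gnp_expect (fun B => c i * \prod_(j <- r) h j B))).
  apply: le_gnp_expect => B.
  rewrite (@eq_resamples _ _ (fun B => h i B * \prod_(j <- r) h j B)); last first.
    by move=> {}B; rewrite big_cons.
  rewrite resamplesMr.
    apply: ler_wpM2r; last by rewrite hc ?mem_head.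
    by rewrite big_seq; apply: prodr_ge0 => j jr; rewrite h0// mr.
  move=> s sL {}B.
  split; apply: eq_big_seq => j jr; have := hind i j s (mem_head _ _) (mr _ jr) _ sL B;
    by case => //; apply: contraNneq ir => ->.
rewrite gnp_expectZ ler_wpM2l// IH//.
- by move=> j B /mr; apply: h0.
- by move=> j /mr; apply: LE.
- by move=> j B /mr; apply: hc.
- by move=> j k s /mr jr /mr kr; apply: hind.
Qed.
End Expectation.

(** * Asymptotically almost sure events and moments of a row of M *)

Section Aas.
Local Open Scope classical_set_scope.
Context {R : realType} (p : R) (hp0 : 0 < p) (hp1 : p < 1).

Lemma gnp_prob_le1 n (P : sgraph n -> Prop) : gnp_prob p P <= 1.
Proof.
rewrite -(@gnp_expect1 R p n) /gnp_prob /gnp_expect [X in _ <= X](bigID (fun G => `[< P G >])) /=.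
rewrite [X in _ <= X + _](eq_bigr (gnp_mass p)) => [|G _]; last by rewrite mulr1.
by rewrite lerDl sumr_ge0// => G _; rewrite mulr1 gnp_mass_ge0.
Qed.

(* Markov's inequality and the union bound in one step. *)
Lemma gnp_prob_ge n (P : sgraph n -> Prop) (I : finType) (Q : pred I)
    (F : I -> {set {set 'I_n}} -> R) :
  (forall i B, 0 <= F i B) ->
  (forall G, ~ P G -> exists2 i, Q i & 1 <= F i (val G)) ->
  1 - \sum_(i | Q i) gnp_expect p (F i) <= gnp_prob p P.
Proof.
move=> F0 PF; rewrite -gnp_expect_sum -(@gnp_expect1 R p n) lerBlDr.
rewrite /gnp_prob big_mkcond -big_split /=; apply: ler_sum => G _.
rewrite mulr1; case: asboolP => PG.
  by rewrite lerDl mulr_ge0 ?gnp_mass_ge0// sumr_ge0.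
have [i Qi Fi] := PF G PG.
rewrite add0r ler_peMr ?gnp_mass_ge0// (le_trans Fi)// (bigD1 i)//= lerDl.
exact: sumr_ge0.
Qed.

Lemma gnp_aas_geometric (P : forall n, sgraph n -> Prop) (A r : R) : 0 <= r < 1 ->
  (\forall n \near \oo, 1 - A * r ^+ n <= gnp_prob p (P n)) -> gnp_aas p P.
Proof.
move=> /andP[r0 r1] H.
apply: (@squeeze_cvgr _ _ _ _ (fun n => 1 - A * r ^+ n) (fun=> 1)).
- by near=> n; rewrite gnp_prob_le1 andbT; near: n.
- rewrite -[X in _ --> X](subr0 (1 : R)); apply: cvgB; first exact: cvg_cst.
  rewrite -[X in _ --> X](mulr0 A); apply: cvgMr; apply: cvg_expr.
  by rewrite ger0_norm.
- exact: cvg_cst.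
Unshelve. all: by end_near.
Qed.

Lemma gnp_aas_and (P Q : forall n, sgraph n -> Prop) :
  gnp_aas p P -> gnp_aas p Q -> gnp_aas p (fun n G => P n G /\ Q n G).
Proof.
move=> hP hQ.
apply: (@squeeze_cvgr _ _ _ _ (fun n => gnp_prob p (P n) + gnp_prob p (Q n) - 1) (fun=> 1)).
- near=> n; rewrite gnp_prob_le1 andbT.
  rewrite -{1}(@gnp_expect1 R p n) lerBlDr /gnp_prob /gnp_expect.
  rewrite !(big_mkcond (fun G => `[< _ >])) -!big_split /=.
  apply: ler_sum => G _; rewrite mulr1; have m0 := gnp_mass_ge0 hp0 hp1 G.
  case: asboolP => PG; case: asboolP => QG; case: (asboolP (_ /\ _)) => PQ; try lra.
  by case: PQ.
- rewrite -[X in _ --> X](addrK (1 : R) 1); apply: cvgB; last exact: cvg_cst.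
  exact: cvgD.
- exact: cvg_cst.
Unshelve. all: by end_near.
Qed.

Lemma gnp_aas_sub (P Q : forall n, sgraph n -> Prop) :
  (\forall n \near \oo, forall G, P n G -> Q n G) -> gnp_aas p P -> gnp_aas p Q.
Proof.
move=> PQ hP.
apply: (@squeeze_cvgr _ _ _ _ (fun n => gnp_prob p (P n)) (fun=> 1)) => //.
- near=> n; rewrite gnp_prob_le1 andbT /gnp_prob.
  rewrite !(big_mkcond (fun G => `[< _ >])) /=; apply: ler_sum => G _.
  have H : forall G, P n G -> Q n G by near: n.
  case: asboolP => PG; case: asboolP => QG//; first by have := H _ PG.
  exact: gnp_mass_ge0.
- exact: cvg_cst.
Unshelve. all: by end_near.
Qed.

End Aas.

Section Rows.
Import mathcomp.boot.finset.
Context {R : realType} (p : R) (hp0 : 0 < p) (hp1 : p < 1) {n : nat}.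
Implicit Types (B : {set {set 'I_n}}) (v : 'I_n -> R).

(** For a centred variable the linear term averages out, which leaves a subgaussian bound. For u at
    most 1/2 it follows from exp u <= 1/(1 - u); for larger u already u <= 2u^2. *)
Lemma expR_le_addr_expR2 (u : R) : expR u <= u + expR (2 * u ^+ 2).
Proof.
have h := expR_ge1Dx (2 * u ^+ 2).
have [u2|u2] := lerP u (1 / 2).
  have hu := expR_ge1Dx (- u); have u0 : 0 < 1 - u by lra.
  have : expR u * (1 - u) <= 1.
    rewrite -[X in _ <= X](expRxMexpNx_1 u) ler_wpM2l ?expR_ge0//; lra.
  have : 1 <= (1 + u + 2 * u ^+ 2) * (1 - u) by nra.
  move=> h1 h2; have := le_trans h2 h1; rewrite ler_pM2r//; lra.
have : expR u <= expR (2 * u ^+ 2) by rewrite ler_expR; nra.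
lra.
Qed.

(** Multiply by 1 + x: the right side becomes 1 + x^3, while exp(-x)(1 + x) <= 1. *)
Lemma expRN_le_quadratic (x : R) : 0 <= x -> expR (- x) <= 1 - x + x ^+ 2.
Proof.
move=> x0; have h := expR_ge1Dx x; have e0 := expR_ge0 (- x).
have h1 : expR (- x) * (1 + x) <= 1.
  by rewrite -[X in _ <= X](expRxMexpNx_1 x) mulrC ler_wpM2r.
have h2 : 1 <= (1 - x + x ^+ 2) * (1 + x) by nra.
by have := le_trans h1 h2; rewrite ler_pM2r//; lra.
Qed.

(** The entries of M; the diagonal vanishes because A and J - I both vanish there. *)
Definition dev B (i j : 'I_n) : R := if i == j then 0 else ([set i; j] \in B)%:R - p.

Lemma dev_indep s i j : s != [set i; j] -> indep_of s (fun B => dev B i j).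
Proof.
by rewrite eq_sym => /negPf sij B; rewrite /dev !inE sij.
Qed.

(** A coordinate of M v + t for v supported on [l]. The shift [t] will stand for a rounding of p s,
    where s is the sum of the eigenvector. *)
Definition row_sum v (t : R) i (l : seq 'I_n) B : R := t + \sum_(j <- l) dev B i j * v j.

Lemma row_sum_indep v t i l s : (forall j, j \in l -> s != [set i; j]) ->
  indep_of s (row_sum v t i l).
Proof.
move=> sl B; split; congr (_ + _); apply: eq_big_seq => j /sl/dev_indep /(_ B)[e1 e2].
  by rewrite e1.
by rewrite e2.
Qed.

Definition row_slots i (l : seq 'I_n) : seq {set 'I_n} := [seq [set i; j] | j <- l].

Lemma set2_injr (i j k : 'I_n) : [set i; j] = [set i; k] -> j = k.
Proof.
move=> e; have := set22 i j; rewrite e !inE => /orP[/eqP ji|/eqP//].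
by have := set22 i k; rewrite -e ji !inE orbb => /eqP ->.
Qed.

Lemma resample_row_sum (f : R -> R) v t i j l B : i != j -> j \notin l ->
  resample p [set i; j] (fun B => f (row_sum v t i (j :: l) B)) B =
  p * f (row_sum v t i l B + (1 - p) * v j) + (1 - p) * f (row_sum v t i l B - p * v j).
Proof.
move=> ij jl.
have sl : forall k, k \in l -> [set i; j] != [set i; k].
  by move=> k kl; apply: contraNneq jl => /set2_injr ->.
have E B' : row_sum v t i (j :: l) B' = row_sum v t i l B' + dev B' i j * v j.
  by rewrite /row_sum big_cons; ring.
rewrite /resample !E; have [-> ->] := row_sum_indep v t sl B.
rewrite /dev (negPf ij) !inE eqxx /=.
by congr (_ * f _ + _ * f _); ring.
Qed.

Lemma resamples_row_sum2 v t i l B : uniq l -> i \notin l ->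
  resamples p (row_slots i l) (fun B => row_sum v t i l B ^+ 2) B =
  t ^+ 2 + p * (1 - p) * \sum_(j <- l) v j ^+ 2.
Proof.
elim: l => [|j l IH] /= => [_ _|]; first by rewrite /row_sum !big_nil; ring.
move=> /andP[jl ul]; rewrite inE negb_or => /andP[ij il].
rewrite (@eq_resamples _ _ _ _ _ (fun B => row_sum v t i l B ^+ 2 + p * (1 - p) * v j ^+ 2)).
  by rewrite resamplesD IH// resamples_cst big_cons; ring.
by move=> B'; rewrite (resample_row_sum (fun x => x ^+ 2))//; ring.
Qed.

(** Averaging one slot of weight w turns y^4 into at most y^4 + 8 w^2 y^2 + 3 w^4. The middle term
    is then evaluated by the exact second moment, and the bound closes up as a square. *)
Lemma resamples_row_sum4 v t i l B : uniq l -> i \notin l ->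
  resamples p (row_slots i l) (fun B => row_sum v t i l B ^+ 4) B <=
  (t ^+ 2 + 4 * \sum_(j <- l) v j ^+ 2) ^+ 2.
Proof.
elim: l => [|j l IH] /= => [_ _|].
  by rewrite /row_sum !big_nil addr0 mulr0 addr0 -exprM.
move=> /andP[jl ul]; rewrite inE negb_or => /andP[ij il].
pose y := row_sum v t i l.
apply: (@le_trans _ _ (resamples p (row_slots i l)
  (fun B => y B ^+ 4 + (8 * v j ^+ 2 * y B ^+ 2 + 3 * v j ^+ 4)) B)).
  apply: le_resamples => // B'; rewrite (resample_row_sum (fun x => x ^+ 4))// -/y.
  set x := y B'; set w := v j.
  have hq0 : 0 <= p * (1 - p) by rewrite mulr_ge0 ?ltW// subr_gt0.
  have hq1 : p * (1 - p) <= 1 by nra.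
  rewrite -subr_ge0.
  (* The skewness term in x w^3 is absorbed by completing a square, so the difference is a sum of
     three nonnegative terms. *)
  rewrite (_ : _ - _ = p * (1 - p) * (2 * w ^+ 2 * (x - (1 - 2 * p) * w) ^+ 2) +
     (1 - p * (1 - p)) * (8 * x ^+ 2 * w ^+ 2)
     + w ^+ 4 * (3 - p * (1 - p) * (2 * (1 - 2 * p) ^+ 2 + (1 - p) ^+ 3 + p ^+ 3))); last by ring.
  have w0 := sqr_ge0 w; have x0 := sqr_ge0 x; have q1 : 0 <= 1 - p * (1 - p) by lra.
  have hq4 : (1 - 2 * p) ^+ 2 <= 1 by nra.
  have hq3 : (1 - p) ^+ 3 + p ^+ 3 <= 1.
    rewrite (_ : _ + _ = 1 - 3 * (p * (1 - p))); [lra | by ring].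
  apply: addr_ge0; first apply: addr_ge0.
  - by rewrite mulr_ge0// mulr_ge0 ?sqr_ge0// mulr_ge0.
  - by rewrite mulr_ge0// mulr_ge0// mulr_ge0.
  - rewrite mulr_ge0 ?(exprM w 2 2) ?sqr_ge0// subr_ge0.
    have -> : 3 = 1 * 3 :> R by rewrite mul1r.
    apply: ler_pM => //; last lra.
    have p3 : 0 <= p ^+ 3 by apply: exprn_ge0; exact: ltW.
    have q3 : 0 <= (1 - p) ^+ 3 by apply: exprn_ge0; rewrite subr_ge0 ltW.
    by have := sqr_ge0 (1 - 2 * p); lra.
rewrite resamplesD resamplesD resamplesZ resamples_cst resamples_row_sum2//.
apply: le_trans (lerD (IH ul il) (lexx _)) _; rewrite big_cons.
have : 0 <= \sum_(k <- l) v k ^+ 2 by apply: sumr_ge0 => k _; apply: sqr_ge0.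
set V := \sum_(k <- l) _; set w := v j => V0.
have hq1 : p * (1 - p) <= 1 by nra.
have : 8 * w ^+ 2 * (p * (1 - p) * V) <= 8 * w ^+ 2 * V.
  by apply: ler_wpM2l; [rewrite mulr_ge0// sqr_ge0 | exact: ler_piMl].
have : 0 <= w ^+ 2 * V by rewrite mulr_ge0// sqr_ge0.
have : 0 <= (w ^+ 2) ^+ 2 by rewrite sqr_ge0.
rewrite (_ : w ^+ 4 = (w ^+ 2) ^+ 2); last by rewrite -exprM.
set W := w ^+ 2 => h1 h2 h3.
nra.
Qed.

(** A row of M v + t is rarely small. Expand the exponential to second order, with V the sum of the
    v_j^2: the mean of the square is at least p(1-p)(t^2 + V), its second moment at most 16 (t^2 +
    V)^2, and the bound on [a] makes the quadratic term at most half of the linear one. *)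
Lemma resamples_row_sum_expN v t i l B (a : R) : uniq l -> i \notin l -> 0 <= a ->
  32 * a * (t ^+ 2 + \sum_(j <- l) v j ^+ 2) <= p * (1 - p) ->
  resamples p (row_slots i l) (fun B => expR (- (a * row_sum v t i l B ^+ 2))) B <=
  expR (- (a * (p * (1 - p)) * (t ^+ 2 + \sum_(j <- l) v j ^+ 2) / 2)).
Proof.
move=> ul il a0.
have V0 : 0 <= \sum_(k <- l) v k ^+ 2 by apply: sumr_ge0 => k _; apply: sqr_ge0.
have hq0 : 0 <= p * (1 - p) by rewrite mulr_ge0 ?ltW// subr_gt0.
have hq1 : p * (1 - p) <= 1 by nra.
move=> ha; apply: (@le_trans _ _ (resamples p (row_slots i l)
  (fun B => 1 + (- a * row_sum v t i l B ^+ 2 + a ^+ 2 * row_sum v t i l B ^+ 4)) B)).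
  apply: le_resamples => // {}B.
  apply: le_trans (expRN_le_quadratic _) _; first by rewrite mulr_ge0 ?sqr_ge0.
  by rewrite le_eqVlt; apply/orP; left; apply/eqP; ring.
rewrite !resamplesD resamples_cst !resamplesZ resamples_row_sum2//.
apply: le_trans (expR_ge1Dx _).
have := resamples_row_sum4 v t B ul il.
set E4 := resamples _ _ _ _ => h4.
have h4' : a ^+ 2 * E4 <= a ^+ 2 * (t ^+ 2 + 4 * \sum_(j <- l) v j ^+ 2) ^+ 2.
  by rewrite ler_wpM2l ?sqr_ge0.
move: V0 ha h4'; set V := \sum_(j <- l) _; set q := p * (1 - p) in hq0 hq1 *.
have := sqr_ge0 t; set T := t ^+ 2 => T0 V0 ha h4'.
rewrite lerD2l (le_trans (lerD (lexx _) h4'))//.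
have h5 : a ^+ 2 * (T + 4 * V) ^+ 2 <= a ^+ 2 * (16 * (T + V) ^+ 2).
  by rewrite ler_wpM2l ?sqr_ge0//; nra.
have h6 : a * (T + V) * (32 * a * (T + V)) <= a * (T + V) * q.
  by rewrite ler_wpM2l// mulr_ge0// addr_ge0.
have h7 : 0 <= a * T * (1 - q) by apply: mulr_ge0; rewrite ?subr_ge0// mulr_ge0.
nra.
Qed.

End Rows.

(** * Euclidean norm and integer nets *)

Section EuclideanNorm.
Context {R : realType} {T : finType}.
Implicit Types x y z : T -> R.

Definition nrm x : R := Num.sqrt (\sum_i x i ^+ 2).

Lemma nrm_ge0 x : 0 <= nrm x. Proof. exact: sqrtr_ge0. Qed.

Lemma sqr_nrm x : nrm x ^+ 2 = \sum_i x i ^+ 2.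
Proof. by rewrite sqr_sqrtr// sumr_ge0// => i _; apply: sqr_ge0. Qed.

Lemma nrm_le x (c : R) : 0 <= c -> \sum_i x i ^+ 2 <= c ^+ 2 -> nrm x <= c.
Proof. by move=> c0 h; rewrite -(ger0_norm c0) -sqrtr_sqr ler_wsqrtr. Qed.

Lemma eq_nrm x y : x =1 y -> nrm x = nrm y.
Proof. by move=> xy; rewrite /nrm; under eq_bigr do rewrite xy. Qed.

Lemma nrm_mono x y : (forall i, `|x i| <= `|y i|) -> nrm x <= nrm y.
Proof.
move=> xy; apply: ler_wsqrtr; apply: ler_sum => i _.
by rewrite -(real_normK (num_real (x i))) -(real_normK (num_real (y i))) lerXn2r ?nnegrE.
Qed.

Lemma nrmZ c x : nrm (fun i => c * x i) = `|c| * nrm x.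
Proof.
rewrite /nrm; under eq_bigr do rewrite exprMn.
by rewrite -mulr_sumr sqrtrM ?sqr_ge0// sqrtr_sqr.
Qed.

Lemma cauchy_schwarz x y : \sum_i x i * y i <= nrm x * nrm y.
Proof.
rewrite -sqrtrM ?sumr_ge0// => [|i _]; last exact: sqr_ge0.
apply: (le_trans (ler_norm _)); rewrite -sqrtr_sqr; apply: ler_wsqrtr.
(* Twice the difference is a full double sum of squares, by Lagrange's identity. *)
rewrite -(ler_pMn2r (ltn0Sn 1)) -subr_ge0.
rewrite (_ : _ - _ = \sum_i \sum_j (x i * y j - x j * y i) ^+ 2).
  by apply: sumr_ge0 => i _; apply: sumr_ge0 => j _; apply: sqr_ge0.
transitivity (\sum_i \sum_j (x i ^+ 2 * y j ^+ 2 + y i ^+ 2 * x j ^+ 2 +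
   (- 2 * (x i * y i)) * (x j * y j))); last first.
  by apply: eq_bigr => i _; apply: eq_bigr => j _; ring.
under [RHS]eq_bigr => i _ do rewrite !big_split /= -!mulr_sumr.
by rewrite !big_split /= -!mulr_suml -mulr_sumr; ring.
Qed.

Lemma nrmD x y : nrm (fun i => x i + y i) <= nrm x + nrm y.
Proof.
apply: nrm_le; first by rewrite addr_ge0// nrm_ge0.
have := cauchy_schwarz x y.
rewrite sqrrD !sqr_nrm; under [X in _ -> X <= _]eq_bigr do rewrite sqrrD.
by rewrite !big_split /=; lra.
Qed.

Lemma ler_nrm x i : `|x i| <= nrm x.
Proof.
rewrite -sqrtr_sqr; apply: ler_wsqrtr; rewrite (bigD1 i)//= lerDl.
by apply: sumr_ge0 => j _; apply: sqr_ge0.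
Qed.

Lemma nrm_cst (c : R) : nrm (fun=> c) = Num.sqrt #|T|%:R * `|c|.
Proof. by rewrite /nrm sumr_const -[_ ^+ 2 *+ _]mulr_natl sqrtrM ?ler0n// sqrtr_sqr. Qed.

Lemma nrm_bounded x (c : R) : (forall i, `|x i| <= c) -> nrm x <= Num.sqrt #|T|%:R * c.
Proof.
(* On an empty index type [c] may be negative, but both sides are then 0. *)
move=> xc; case: (pickP (fun=> true) : pick_spec (fun _ : T => true) _) => [i _|T0].
  have c0 : 0 <= c by apply: le_trans (xc i).
  by rewrite -[X in _ * X](ger0_norm c0) -nrm_cst; apply: nrm_mono => j; rewrite (ger0_norm c0).
by rewrite /nrm big_pred0// eq_card0 ?sqrtr0 ?mul0r// => i; have := T0 i.
Qed.

Lemma sum_norm_le (P : pred T) x : \sum_(i | P i) `|x i| <= Num.sqrt #|P|%:R * nrm x.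
Proof.
have cs := cauchy_schwarz (fun i => (P i)%:R) (fun i => `|x i|).
have nx : nrm (fun i => `|x i|) <= nrm x by apply: nrm_mono => i; rewrite normr_id.
have nP : nrm (fun i => (P i)%:R : R) = Num.sqrt #|P|%:R.
  rewrite /nrm -sum1_card natr_sum [in RHS]big_mkcond /=; congr (Num.sqrt _).
  by apply: eq_bigr => i _; rewrite -topredE /=; case: (P i); rewrite ?expr1n ?expr0n.
rewrite -nP; apply: le_trans (ler_wpM2l (nrm_ge0 _) nx); apply: le_trans cs.
by rewrite big_mkcond; apply: ler_sum => i _; case: (P i); rewrite ?mul1r ?mul0r.
Qed.

End EuclideanNorm.

Section Net.
Context {R : realType}.

(* A bounded integer, as a difference of two naturals. *)
Definition letter (N : nat) : finType := ('I_N.+1 * 'I_N.+1)%type.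
Definition lval {N} (c : letter N) : R := c.1%:R - c.2%:R.
Definition lsize {N} (c : letter N) : nat := c.1 + c.2.

Definition word (N n : nat) : finType := {ffun 'I_n -> letter N}.
Definition wsize {N n} (k : word N n) : nat := \sum_i lsize (k i).

(** [Num.truncn] vanishes on negative reals, so the two coordinates hold the truncated positive and
    negative parts. Thus [lval] rounds x towards 0 as long as |x| <= N. *)
Definition trunc_letter N (x : R) : letter N :=
  (inord (Num.truncn x), inord (Num.truncn (- x))).

Lemma trunc_letterP N (x : R) : `|x| <= N%:R ->
  [/\ `|x - lval (trunc_letter N x)| <= 1, `|lval (trunc_letter N x)| <= `|x|
    & (lsize (trunc_letter N x))%:R <= `|x|].
Proof.
have main (z : R) : 0 <= z <= N%:R ->
    let t := lval (trunc_letter N z) in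
    [/\ `|z - t| <= 1, `|t| <= z, lval (trunc_letter N (- z)) = - t,
      (lsize (trunc_letter N z))%:R <= z & lsize (trunc_letter N (- z)) = lsize (trunc_letter N z)].
  move=> /andP[z0 zN].
  have /andP[t1 t2] := truncn_itv z0.
  have tN : (Num.truncn z < N.+1)%N.
    by rewrite ltnS -(ler_nat R) (le_trans t1).
  have t0 : Num.truncn (- z) = 0%N.
    by apply/truncn0Pn; rewrite -ltNge; lra.
  rewrite /lval /lsize /trunc_letter /= opprK t0 !inordK// subr0 sub0r addn0 add0n.
  rewrite -natr1 in t2; split=> //; last by rewrite ger0_norm ?ler0n.
  by rewrite ler_norml; lra.
move=> xN; have [x0|x0] := lerP 0 x.
  rewrite ger0_norm// in xN *; have [] := main x; first by rewrite x0.
  by [].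
rewrite ltr0_norm// in xN *; have [] := main (- x); first by rewrite xN; lra.
rewrite opprK => h1 h2 h3 h4 h5; rewrite h5 h3 normrN; split=> //.
by rewrite -normrN opprD opprK.
Qed.

Definition trunc_word N n (x : 'I_n -> R) : word N n := [ffun i => trunc_letter N (x i)].

Lemma wsize_trunc N n (x : 'I_n -> R) : (forall i, `|x i| <= N%:R) ->
  (wsize (trunc_word N x))%:R <= \sum_i `|x i|.
Proof.
move=> xN; rewrite natr_sum; apply: ler_sum => i _; rewrite ffunE.
by case: (trunc_letterP (xN i)).
Qed.

Lemma geometric_sum_le N (q : R) : 0 < q < 1 -> \sum_(i < N) q ^+ i <= (1 - q)^-1.
Proof.
move=> /andP[q0 q1]; rewrite -[leRHS]mul1r ler_pdivlMr ?subr_gt0//.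
have := subrX1 q N; rewrite mulrC => e.
have : 0 <= q ^+ N by rewrite exprn_ge0// ltW.
rewrite (_ : _ * (1 - q) = 1 - q ^+ N); last first.
  by rewrite -[RHS]opprB e -mulrN opprB.
lra.
Qed.

(** A generating function bound: a word of size at most D has weight q^size >= q^D, and the total
    weight factors into 2n geometric sums, two for each coordinate. The parameter q is left free to
    be tuned to D. *)
Lemma card_words N n D (q : R) : 0 < q < 1 ->
  #|[set k : word N n | (wsize k <= D)%N]|%:R <= q ^- D * (1 - q) ^- (2 * n).
Proof.
move=> /andP[q0 q1]; rewrite ler_pdivlMl ?exprn_gt0//.
apply: (@le_trans _ _ (\sum_(k : word N n) \prod_i q ^+ lsize (k i))).
  rewrite mulr_natr -sumr_const big_mkcond /=; apply: ler_sum => k _.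
  rewrite inE; case: ifPn => kD; last by apply: prodr_ge0 => i _; rewrite exprn_ge0// ltW.
  rewrite prodrXr; apply: ler_wiXn2l; rewrite ?ltW//.
rewrite -(bigA_distr_bigA (fun _ c => q ^+ lsize c)) prodr_const card_ord.
rewrite exprM -exprVn lerXn2r ?nnegrE ?sumr_ge0// => [c _||].
- by rewrite exprn_ge0// ltW.
- by rewrite invr_ge0 exprn_ge0// subr_ge0 ltW.
have E : \sum_(c : letter N) q ^+ lsize c = (\sum_(i < N.+1) q ^+ i) ^+ 2.
  rewrite expr2 mulr_suml; under [RHS]eq_bigr do rewrite mulr_sumr.
  by rewrite pair_bigA /=; apply: eq_bigr => c _; rewrite exprD.
rewrite E -exprVn lerXn2r ?nnegrE ?invr_ge0 ?subr_ge0 ?sumr_ge0 ?(ltW q1)// => [i _|].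
  by rewrite exprn_ge0// ltW.
by apply: geometric_sum_le; rewrite q0.
Qed.

End Net.

(** * The operator norm of the centred adjacency matrix *)

Section OperatorNorm.
Import mathcomp.boot.finset.
Context {R : realType} (p : R) (hp0 : 0 < p) (hp1 : p < 1).

Definition mvec {n} (B : {set {set 'I_n}}) (x : 'I_n -> R) i : R :=
  \sum_j dev p B i j * x j.

Definition bil {n} (B : {set {set 'I_n}}) (y x : 'I_n -> R) : R :=
  \sum_i y i * mvec B x i.

Lemma devC n (B : {set {set 'I_n}}) i j : dev p B i j = dev p B j i.
Proof. by rewrite /dev eq_sym setUC. Qed.

Lemma norm_dev_le1 n (B : {set {set 'I_n}}) i j : `|dev p B i j| <= 1.
Proof.
have h (b : bool) : `|b%:R - p| <= 1 by have := hp0; have := hp1; case: b; rewrite ler_norml /=; lra.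
by rewrite /dev; case: ifP => _; first by rewrite normr0.
Qed.

Lemma mvecD n (B : {set {set 'I_n}}) x y i :
  mvec B (fun i => x i + y i) i = mvec B x i + mvec B y i.
Proof. by rewrite -big_split; apply: eq_bigr => j _; rewrite mulrDr. Qed.

Lemma mvecZ n (B : {set {set 'I_n}}) c x i :
  mvec B (fun i => c * x i) i = c * mvec B x i.
Proof. by rewrite mulr_sumr; apply: eq_bigr => j _; ring. Qed.

Lemma eq_mvec n (B : {set {set 'I_n}}) x y : x =1 y -> mvec B x =1 mvec B y.
Proof. by move=> xy i; apply: eq_bigr => j _; rewrite xy. Qed.

Lemma bilZ n (B : {set {set 'I_n}}) c d y x :
  bil B (fun i => c * y i) (fun i => d * x i) = c * d * bil B y x.
Proof. by rewrite mulr_sumr; apply: eq_bigr => i _; rewrite mvecZ; ring. Qed.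

Lemma bilDl n (B : {set {set 'I_n}}) y z x :
  bil B (fun i => y i + z i) x = bil B y x + bil B z x.
Proof. by rewrite -big_split; apply: eq_bigr => i _; rewrite mulrDl. Qed.

Lemma bilDr n (B : {set {set 'I_n}}) y z x :
  bil B x (fun i => y i + z i) = bil B x y + bil B x z.
Proof. by rewrite -big_split; apply: eq_bigr => i _; rewrite mvecD mulrDr. Qed.

Lemma eq_bil n (B : {set {set 'I_n}}) y y' x x' : y =1 y' -> x =1 x' ->
  bil B y x = bil B y' x'.
Proof. by move=> yy' xx'; apply: eq_bigr => i _; rewrite yy' (eq_mvec _ xx'). Qed.

Lemma bil_pairs n (B : {set {set 'I_n}}) y x :
  bil B y x = \sum_(ij : 'I_n * 'I_n | (ij.1 < ij.2)%N)
    (y ij.1 * x ij.2 + y ij.2 * x ij.1) * dev p B ij.1 ij.2.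
Proof.
pose g ij : R := y ij.1 * (dev p B ij.1 ij.2 * x ij.2).
have -> : bil B y x = \sum_(ij : 'I_n * 'I_n) g ij.
  by rewrite -(pair_bigA _ (fun i j => g (i, j))); apply: eq_bigr => i _; rewrite mulr_sumr.
rewrite (bigID (fun ij : 'I_n * 'I_n => (ij.1 < ij.2)%N)) /=.
have -> : \sum_(ij : 'I_n * 'I_n | ~~ (ij.1 < ij.2)%N) g ij =
    \sum_(ij : 'I_n * 'I_n | (ij.2 < ij.1)%N) g ij.
  rewrite big_mkcond [RHS]big_mkcond; apply: eq_bigr => -[i j] _ /=.
  case: ltngtP => //= /val_inj ->.
  by rewrite /g /dev eqxx mul0r mulr0.
rewrite [X in _ + X](reindex_inj (_ : injective (fun ij : 'I_n * 'I_n => (ij.2, ij.1)))) /=.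
  rewrite -big_split; apply: eq_bigr => -[i j] _ /=.
  by rewrite /g /= (devC B j i); ring.
by move=> [a b] [c d] [-> ->].
Qed.

(** M is symmetric, so the form is a sum over pairs i < j of independent centred variables. Each
    pair contributes a subgaussian factor whose exponent is twice its squared coefficient. *)
Lemma hoeffding_bil n (th : R) (y x : 'I_n -> R) :
  gnp_expect p (fun B => expR (th * bil B y x)) <=
  expR (4 * th ^+ 2 * nrm y ^+ 2 * nrm x ^+ 2).
Proof.
pose P : pred ('I_n * 'I_n) := fun ij => (ij.1 < ij.2)%N.
pose c ij := th * (y ij.1 * x ij.2 + y ij.2 * x ij.1).
pose h ij B := expR (c ij * dev p B ij.1 ij.2).
rewrite (_ : (fun B => _) = (fun B => \prod_(ij <- enum P) h ij B)); last first.
  apply/funext => B; rewrite -expR_sum big_enum /=; congr expR.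
  rewrite bil_pairs mulr_sumr; apply: eq_bigr => ij _; rewrite /c; ring.
have ne (ij : 'I_n * 'I_n) : (ij.1 < ij.2)%N -> ij.1 == ij.2 = false.
  by move=> h0; apply/negbTE; apply: contraTneq h0 => ->; rewrite ltnn.
apply: (le_trans (@gnp_expect_blocks _ _ _ hp0 hp1 _ _ h
   (fun ij => [:: [set ij.1; ij.2]]) (fun ij => expR (2 * c ij ^+ 2)) _ _ _ _ _)).
- exact: enum_uniq.
- by move=> *; apply: expR_ge0.
- move=> ij; rewrite mem_enum => /ne nij s; rewrite !inE => /eqP ->.
  by rewrite cards2 nij.
- move=> ij B; rewrite mem_enum => /ne nij /=.
  rewrite /resample /h /dev nij !inE eqxx /=.
  set u := c ij; have p0 := hp0; have p1 := hp1.
  have h1 := expR_le_addr_expR2 (u * (true%:R - p)).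
  have h2 := expR_le_addr_expR2 (u * (false%:R - p)).
  have h3 : expR (2 * (u * (true%:R - p)) ^+ 2) <= expR (2 * u ^+ 2).
    rewrite ler_expR ler_pM2l// exprMn ler_piMr ?sqr_ge0//= ; nra.
  have h4 : expR (2 * (u * (false%:R - p)) ^+ 2) <= expR (2 * u ^+ 2).
    rewrite ler_expR ler_pM2l// exprMn ler_piMr ?sqr_ge0//= ; nra.
  have q0 : 0 < 1 - p by lra.
  have := ler_wpM2l (ltW hp0) (le_trans h1 (lerD (lexx _) h3)).
  have := ler_wpM2l (ltW q0) (le_trans h2 (lerD (lexx _) h4)).
  rewrite /=; lra.
- move=> ij kl s; rewrite !mem_enum /= => hij hkl ijkl; rewrite inE => /eqP -> B.
  have neq : [set ij.1; ij.2] != [set kl.1; kl.2].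
    apply: contra_neq ijkl; case: ij kl hij hkl => i j [k l]; rewrite /in_mem /= /P /= => hij hkl e.
    have := set21 i j; have := set22 i j; rewrite e !inE => /orP[]/eqP ? /orP[]/eqP ?; subst => //.
    - by rewrite ltnn in hij.
    - by have := ltn_trans hij hkl; rewrite ltnn.
    - by rewrite ltnn in hij.
  by rewrite /h; have [-> ->] := dev_indep p neq B.
rewrite -expR_sum ler_expR big_enum /= -mulr_sumr.
(* From (a + b)^2 <= 2 a^2 + 2 b^2, the two halves of each pair together form the sum over all
   ordered pairs. *)
apply: (@le_trans _ _ (2 * (2 * th ^+ 2 * \sum_(ij : 'I_n * 'I_n) (y ij.1 * x ij.2) ^+ 2))); last first.
  rewrite -(pair_bigA _ (fun i j => (y i * x j) ^+ 2)) /= !sqr_nrm.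
  rewrite le_eqVlt; apply/orP; left; apply/eqP.
  rewrite -[in RHS]mulrA mulr_suml; under eq_bigr do under eq_bigr do rewrite exprMn.
  by under eq_bigr do rewrite -mulr_sumr; ring.
rewrite ler_pM2l// mulr_sumr.
have -> : \sum_(ij : 'I_n * 'I_n) 2 * th ^+ 2 * (y ij.1 * x ij.2) ^+ 2 =
   \sum_(ij : 'I_n * 'I_n | P ij) 2 * th ^+ 2 * (y ij.1 * x ij.2) ^+ 2 +
   \sum_(ij : 'I_n * 'I_n | ~~ P ij) 2 * th ^+ 2 * (y ij.1 * x ij.2) ^+ 2.
  by rewrite (bigID P).
apply: (@le_trans _ _ (\sum_(ij : 'I_n * 'I_n | P ij) 2 * th ^+ 2 * (y ij.1 * x ij.2) ^+ 2 +
   \sum_(ij : 'I_n * 'I_n | P ij) 2 * th ^+ 2 * (y ij.2 * x ij.1) ^+ 2)).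
  rewrite -big_split; apply: ler_sum => ij _ /=; rewrite /c.
  have := sqr_ge0 (th * (y ij.1 * x ij.2 - y ij.2 * x ij.1)); nra.
rewrite lerD2l (reindex_inj (_ : injective (fun ij : 'I_n * 'I_n => (ij.2, ij.1)))) /=; last first.
  by move=> [a b] [c' d] [-> ->].
rewrite big_mkcond [leRHS]big_mkcond; apply: ler_sum => -[i j] _; rewrite /P /=.
have g0 (a b : R) : 0 <= 2 * th ^+ 2 * (a * b) ^+ 2.
  by rewrite mulr_ge0 ?sqr_ge0// mulr_ge0// sqr_ge0.
by case: ltngtP => //= _; rewrite g0.
Qed.

(** One-sided, since [y] may be replaced by its negative. *)
Definition opnorm_le {n} (B : {set {set 'I_n}}) (C : R) :=
  forall y x : 'I_n -> R, bil B y x <= C * nrm y * nrm x.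

(* Rounding both vectors of a near-extremal pair costs at most half of the
   supremum of the form over the ball, hence the factor 2. *)
Lemma bil_le_net n (B : {set {set 'I_n}}) (m : R) (N : nat) :
  let rho : R := 4 * Num.sqrt n%:R in rho <= N%:R ->
  (forall k l : word N n, (wsize k <= 4 * n)%N -> (wsize l <= 4 * n)%N ->
     nrm (fun i => lval (k i) : R) <= rho -> nrm (fun i => lval (l i) : R) <= rho ->
     bil B (fun i => lval (l i)) (fun i => lval (k i)) <= m) ->
  forall y x, nrm y <= rho -> nrm x <= rho -> bil B y x <= 2 * m.
Proof.
move=> rho rhoN hnet.
pose E : set R := fun r => exists y x, [/\ nrm y <= rho, nrm x <= rho & r = bil B y x].
have rho0 : 0 <= rho by rewrite mulr_ge0// sqrtr_ge0.
have nrm0 : nrm (fun _ : 'I_n => 0 : R) <= rho.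
  by rewrite nrm_cst normr0 mulr0.
have hsup : has_sup E.
  split; first by exists (bil B (fun=> 0) (fun=> 0)), (fun=> 0), (fun=> 0).
  (* A crude entrywise bound, only to make the supremum finite. *)
  exists (\sum_(i < n) \sum_(j < n) rho * rho) => r [y [x [yr xr ->]]].
  apply: ler_sum => i _; rewrite mulr_sumr; apply: ler_sum => j _.
  apply: (le_trans (ler_norm _)); rewrite !normrM.
  rewrite ler_pM ?mulr_ge0//; first exact: le_trans (ler_nrm _ _) yr.
  rewrite -[leRHS]mul1r ler_pM ?norm_dev_le1//; exact: le_trans (ler_nrm _ _) xr.
have ubE y x : nrm y <= rho -> nrm x <= rho -> bil B y x <= sup E.
  by move=> yr xr; apply: sup_upper_bound => //; exists y, x.
suff : sup E <= m + sup E / 2 by move=> h y x yr xr; have := ubE y x yr xr; lra.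
apply: sup_le_ub; first by case: hsup.
move=> r [y [x [yr xr ->]]].
pose k := trunc_word N x; pose l := trunc_word N y.
have bnd (z : 'I_n -> R) i : nrm z <= rho -> `|z i| <= N%:R.
  by move=> zr; apply: le_trans (ler_nrm _ _) (le_trans zr rhoN).
have rnd (z : 'I_n -> R) : nrm z <= rho ->
   [/\ (wsize (trunc_word N z) <= 4 * n)%N,
       nrm (fun i => lval (trunc_word N z i) : R) <= rho
     & nrm (fun i => 4 * (z i - lval (trunc_word N z i))) <= rho].
  move=> zr; have zN i := bnd z i zr; split.
  - rewrite -(ler_nat R); apply: le_trans (wsize_trunc zN) _.
    apply: le_trans (sum_norm_le predT z) _; rewrite cardT size_enum_ord.
    apply: le_trans (ler_wpM2l (sqrtr_ge0 _) zr) _.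
    by rewrite natrM mulrCA -expr2 sqr_sqrtr.
  - apply: le_trans zr; apply: nrm_mono => i; rewrite ffunE.
    by case: (trunc_letterP (zN i)).
  - rewrite nrmZ ger0_norm// ler_pM2l//.
    have := @nrm_bounded _ _ (fun i => z i - lval (trunc_word N z i)) 1.
    rewrite mulr1 card_ord; apply => i; rewrite ffunE.
    by case: (trunc_letterP (zN i)).
have [k1 k2 k3] := rnd x xr; have [l1 l2 l3] := rnd y yr.
(* The rounding errors have norm at most sqrt n = rho / 4. Scaled by 4 they are back in the ball, so
   each error term costs a quarter of the supremum. *)
have -> : bil B y x = bil B (fun i => lval (l i)) (fun i => lval (k i)) +
   1 / 4 * bil B (fun i => lval (l i)) (fun i => 4 * (x i - lval (k i))) +
   1 / 4 * bil B (fun i => 4 * (y i - lval (l i))) x.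
  have ex : x =1 fun i => lval (k i) + (x i - lval (k i)) by move=> i; rewrite addrC subrK.
  have ey : y =1 fun i => lval (l i) + (y i - lval (l i)) by move=> i; rewrite addrC subrK.
  rewrite (eq_bil B ey (frefl x)) bilDl (eq_bil B (frefl _) ex) bilDr.
  congr (_ + _ + _).
  - by rewrite -[1 / 4]mul1r -bilZ; apply: eq_bil => i; [rewrite mul1r | field].
  - by rewrite -[1 / 4]mulr1 -bilZ; apply: eq_bil => i; [field | rewrite mul1r].
have := hnet k l k1 l1 k2 l2.
have := ubE _ _ l2 k3; have := ubE _ _ l3 xr; lra.
Qed.

Lemma opnorm_le_ball n (B : {set {set 'I_n}}) (rho m : R) : 0 < rho ->
  (forall y x, nrm y <= rho -> nrm x <= rho -> bil B y x <= m) ->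
  opnorm_le B (m / rho ^+ 2).
Proof.
move=> rho0 h y x.
(* The zero vector is written as 0 * 0 so that [bilZ] applies to it. *)
have nz (z : 'I_n -> R) : nrm z = 0 -> z =1 fun=> 0 * 0.
  by move=> z0 i; have := ler_nrm z i; rewrite z0 normr_le0 mul0r => /eqP.
have [y0|y0] := eqVneq (nrm y) 0.
  rewrite y0 mulr0 mul0r (eq_bil B (nz y y0) (fun i => esym (mul1r _))).
  by rewrite bilZ !mul0r.
have [x0|x0] := eqVneq (nrm x) 0.
  rewrite x0 mulr0 (eq_bil B (fun i => esym (mul1r _)) (nz x x0)).
  by rewrite bilZ !mulr0 mul0r.
have yp : 0 < nrm y by rewrite lt_neqAle eq_sym y0 nrm_ge0.
have xp : 0 < nrm x by rewrite lt_neqAle eq_sym x0 nrm_ge0.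
have hr (z : 'I_n -> R) : 0 < nrm z -> nrm (fun i => rho / nrm z * z i) <= rho.
  move=> z0; rewrite nrmZ ger0_norm; first by rewrite divfK ?gt_eqF.
  by rewrite divr_ge0 ?ltW.
have := h _ _ (hr y yp) (hr x xp); rewrite bilZ => hb.
rewrite -(@ler_pM2l _ (rho / nrm y * (rho / nrm x))) ?mulr_gt0 ?invr_gt0//.
apply: le_trans hb _; rewrite le_eqVlt; apply/orP; left; apply/eqP.
by field; rewrite x0 y0 gt_eqF.
Qed.

Lemma gnp_aas_opnorm :
  gnp_aas p (fun n (G : sgraph n) => opnorm_le (val G) (130 * Num.sqrt n%:R)).
Proof.
apply: (@gnp_aas_geometric _ _ hp0 hp1 _ 1 (expR (-1))).
  by rewrite expR_ge0 expR_lt1 ltrN10.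
near=> n; have n0 : (0 < n)%N by near: n; exists 1%N.
pose rho : R := 4 * Num.sqrt n%:R.
have s0 : 0 < Num.sqrt n%:R :> R by rewrite sqrtr_gt0 ltr0n.
have s1 : 1 <= Num.sqrt n%:R :> R.
  by rewrite -[leLHS]sqrtr1 ler_wsqrtr// ler1n.
have ss : Num.sqrt n%:R * Num.sqrt n%:R = n%:R :> R by rewrite -expr2 sqr_sqrtr.
have rho0 : 0 < rho by rewrite mulr_gt0.
pose N := (4 * n)%N.
(* Exponential Markov with parameter 1 / sqrt n: Hoeffding contributes exp(1024 n) and there are at
   most exp(12 n) pairs of words, so 1037 = 1024 + 12 + 1 leaves exp(-n). Finally 2 m / rho^2 =
   129.625 sqrt n, below the constant 130. *)
pose m : R := 1037 * n%:R * Num.sqrt n%:R.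
pose Q (kl : word N n * word N n) := [&& (wsize kl.1 <= 4 * n)%N, (wsize kl.2 <= 4 * n)%N,
   nrm (fun i => lval (kl.1 i) : R) <= rho & nrm (fun i => lval (kl.2 i) : R) <= rho].
pose F (kl : word N n * word N n) (B : {set {set 'I_n}}) : R :=
  expR (- ((Num.sqrt n%:R)^-1 * m)) *
   expR ((Num.sqrt n%:R)^-1 * bil B (fun i => lval (kl.2 i)) (fun i => lval (kl.1 i))).
apply: le_trans; last apply: (@gnp_prob_ge _ _ hp0 hp1 n _ _ Q F); last first.
- move=> G nG; apply: contrapT => noF; apply: nG.
  have hb : forall y x, nrm y <= rho -> nrm x <= rho -> bil (val G) y x <= 2 * m.
    apply: (@bil_le_net _ _ _ N); first by rewrite natrM ler_pM2l// -[leRHS]ss ler_peMr// ltW.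
    move=> k l k1 l1 k2 l2; rewrite leNgt; apply/negP => hm; apply: noF.
    exists (k, l); first by rewrite /Q /= k1 l1 k2 l2.
    rewrite /F -expRD -[leLHS]expR0 ler_expR /= addrC subr_ge0.
    by rewrite ler_pM2l ?invr_gt0// ltW.
  move=> y x; apply: le_trans (opnorm_le_ball rho0 hb y x) _.
  rewrite ler_wpM2r ?nrm_ge0// ler_wpM2r ?nrm_ge0//.
  rewrite /m /rho; move: ss s0; set s := Num.sqrt _ => ss s0; rewrite -ss.
  rewrite (_ : _ / _ = (2 * 1037 / 16) * s); last by field; rewrite gt_eqF.
  by rewrite ler_pM2r//; lra.
- by move=> *; rewrite mulr_ge0 ?expR_ge0.
rewrite lerD2l lerN2 mul1r.
apply: (@le_trans _ _ (\sum_(kl | Q kl) expR (- 13%:R * n%:R))).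
  apply: ler_sum => kl /and4P[_ _ k2 l2].
  rewrite gnp_expectZ.
  apply: le_trans (ler_wpM2l (expR_ge0 _) (hoeffding_bil _ _ _)) _.
  rewrite -expRD ler_expR.
  have hk : nrm (fun i => lval (kl.1 i) : R) ^+ 2 <= 16 * n%:R.
    apply: (@le_trans _ _ (rho ^+ 2)); first by rewrite lerXn2r ?nnegrE ?nrm_ge0 ?(ltW rho0).
    by rewrite /rho exprMn sqr_sqrtr//; lra.
  have hl : nrm (fun i => lval (kl.2 i) : R) ^+ 2 <= 16 * n%:R.
    apply: (@le_trans _ _ (rho ^+ 2)); first by rewrite lerXn2r ?nnegrE ?nrm_ge0 ?(ltW rho0).
    by rewrite /rho exprMn sqr_sqrtr//; lra.
  have := ler_pM (sqr_ge0 _) (sqr_ge0 _) hl hk.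
  set a := nrm _ ^+ 2; set b := nrm _ ^+ 2 => hab.
  have n0' : 0 < n%:R :> R by rewrite ltr0n.
  have e1 : (Num.sqrt n%:R)^-1 * m = 1037 * n%:R by rewrite /m; field; rewrite gt_eqF.
  have e2 : (Num.sqrt n%:R)^-1 ^+ 2 = n%:R^-1 :> R by rewrite exprVn sqr_sqrtr.
  rewrite e1 e2 -mulrA.
  have : 4 / n%:R * (a * b) <= 4 / n%:R * (16 * n%:R * (16 * n%:R)).
    by rewrite ler_pM2l// divr_gt0.
  rewrite (_ : 4 / n%:R * (16 * n%:R * (16 * n%:R)) = 1024 * n%:R); last by field; rewrite gt_eqF.
  lra.
rewrite sumr_const -[_ *+ _]mulr_natl.
pose A := [set k : word N n | (wsize k <= 4 * n)%N].
have cA : #|A|%:R <= (expR 1 : R) ^+ (6 * n).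
  apply: (@le_trans _ _ ((1/2 : R) ^- (4 * n) * (1 - 1/2) ^- (2 * n))).
    by apply: card_words; lra.
  rewrite (_ : 1 - 1/2 = 1/2 :> R); last by field.
  rewrite -!exprVn -exprD -mulnDl (_ : (1/2)^-1 = 1 + 1 :> R); last by field.
  by rewrite lerXn2r ?nnegrE ?expR_ge0// expR_ge1Dx.
have cQ : (#|[pred kl | Q kl]| <= #|A| * #|A|)%N.
  rewrite -cardsX -[#|[pred _ | _]|]cardsE subset_leq_card//.
  by apply/fintype.subsetP => kl; rewrite !inE => /and4P[-> ->].
apply: (@le_trans _ _ (expR 1 ^+ (6 * n) * expR 1 ^+ (6 * n) * expR (- 13 * n%:R))).
  rewrite ler_wpM2r ?expR_ge0//.
  apply: (@le_trans _ _ (#|A| * #|A|)%:R); first by rewrite ler_nat.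
  by rewrite natrM ler_pM.
rewrite -!expRM_natl -!expRD ler_expR natrM; lra.
Unshelve. all: by end_near.
Qed.

End OperatorNorm.

(** * Union bounds *)

Section UnionBounds.
Import mathcomp.boot.finset.
Context {R : realType} (p : R) (hp0 : 0 < p) (hp1 : p < 1).

(** Since U and W are disjoint, distinct pairs of U x W are distinct slots, hence independent. *)
Lemma gnp_expect_no_edge n (U W : {set 'I_n}) : [disjoint U & W] ->
  gnp_expect p (fun B => \prod_(uw in setX U W) ([set uw.1; uw.2] \notin B)%:R) <=
  (1 - p) ^+ (#|U| * #|W|).
Proof.
move=> dUW.
have dis u : u \in U -> u \in W -> False.
  by move=> uU; rewrite (disjointFr dUW uU).
pose h (uw : 'I_n * 'I_n) (B : {set {set 'I_n}}) : R := ([set uw.1; uw.2] \notin B)%:R.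
rewrite (_ : (fun B => _) = (fun B => \prod_(uw <- enum (setX U W)) h uw B)); last first.
  by apply/funext => B; rewrite big_enum.
apply: (le_trans (@gnp_expect_blocks _ _ _ hp0 hp1 _ _ h
   (fun uw => [:: [set uw.1; uw.2]]) (fun=> 1 - p) _ _ _ _ _)).
- exact: enum_uniq.
- by move=> *; rewrite /h ler0n.
- move=> uw; rewrite mem_enum inE => /andP[uU wW] s; rewrite !inE => /eqP ->.
  have ne : uw.1 != uw.2 by apply/eqP => e; apply: (dis uw.1) => //; rewrite e.
  by rewrite cards2 ne.
- by move=> uw B _ /=; rewrite /resample /h !inE eqxx /= mulr0 add0r mulr1.
- move=> [u w] [u' w'] s; rewrite !mem_enum !inE /= => /andP[uU wW] /andP[uU' wW'] ne.
  move=> /eqP -> B; rewrite /h /= !inE.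
  have -> : ([set u'; w'] == [set u; w]) = false; last by [].
  apply: contraNF ne => /eqP e; rewrite xpair_eqE.
  have := set21 u w; rewrite -e !inE => /orP[/eqP uu|/eqP uw']; last first.
    by case: (dis u); rewrite // uw'.
  have := set22 u w; rewrite -e !inE => /orP[/eqP wu|/eqP ww']; last by rewrite uu ww' !eqxx.
  by case: (dis u') => //; rewrite -wu.
by rewrite big_enum /= prodr_const cardsX.
Qed.

Lemma gnp_aas_edge_between (eps : R) : 0 < eps ->
  exists K : nat, gnp_aas p (fun n (G : sgraph n) =>
    forall U W : {set 'I_n}, [disjoint U & W] -> (K <= #|U|)%N ->
      eps * n%:R <= #|W|%:R -> exists u w, [/\ u \in U, w \in W & adj G u w]).
Proof.
(* With p eps K >= 3 a given pair (U, W) has no edge with probability at most exp(-3n), against at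
   most 4^n <= exp(2n) pairs. *)
move=> eps0; pose K := (Num.truncn (3 / (p * eps))).+1; exists K.
have pe0 : 0 < p * eps by rewrite mulr_gt0.
have hK : 3 <= p * eps * K%:R.
  by rewrite -ler_pdivrMl// mulrC ltW// truncnS_gt.
apply: (@gnp_aas_geometric _ _ hp0 hp1 _ 1 (expR (-1))).
  by rewrite expR_ge0 expR_lt1 ltrN10.
near=> n.
pose Q (UW : {set 'I_n} * {set 'I_n}) :=
  [&& [disjoint UW.1 & UW.2], (K <= #|UW.1|)%N & eps * n%:R <= #|UW.2|%:R].
pose F (UW : {set 'I_n} * {set 'I_n}) (B : {set {set 'I_n}}) : R :=
  \prod_(uw in setX UW.1 UW.2) ([set uw.1; uw.2] \notin B)%:R.
apply: le_trans; last apply: (@gnp_prob_ge _ _ hp0 hp1 n _ _ Q F); last first.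
- move=> G nG; apply: contrapT => noF; apply: nG => U W dUW UK We.
  apply: contrapT => noe; apply: noF; exists (U, W); first by rewrite /Q /= dUW UK We.
  rewrite /F big1// => -[u w]; rewrite inE /= => /andP[uU wW].
  case: (boolP (_ \in _)) => //= e; case: noe; exists u, w; split => //.
- by move=> *; apply: prodr_ge0 => *; rewrite ler0n.
rewrite lerD2l lerN2 mul1r.
apply: (@le_trans _ _ (\sum_(UW | Q UW) expR (- 3 * n%:R))).
  apply: ler_sum => -[U W] /and3P[/= dUW UK We].
  apply: le_trans (gnp_expect_no_edge dUW) _.
  apply: (@le_trans _ _ (expR (- p) ^+ (#|U| * #|W|))).
    by rewrite lerXn2r ?nnegrE ?expR_ge0 ?subr_ge0 ?(ltW hp1)// expR_ge1Dx.
  rewrite -expRM_natl ler_expR natrM mulrN mulNr lerN2.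
  apply: (@le_trans _ _ (p * eps * K%:R * n%:R)); first by rewrite ler_wpM2r.
  rewrite (_ : p * eps * K%:R * n%:R = K%:R * (eps * n%:R) * p); last by ring.
  apply: ler_wpM2r; first exact: ltW.
  by apply: ler_pM; rewrite ?ler_nat// mulr_ge0// ltW.
rewrite sumr_const -[_ *+ _]mulr_natl.
apply: (@le_trans _ _ (expR (2 * n%:R) * expR (- 3 * n%:R))).
  rewrite ler_wpM2r ?expR_ge0//.
  apply: (@le_trans _ _ (expR 1 ^+ (2 * n))); last by rewrite -expRM_natl natrM mulr1.
  apply: (@le_trans _ _ ((1 + 1) ^+ (2 * n))).
    rewrite (_ : 1 + 1 = 2%:R)// -natrX ler_nat.
    apply: leq_trans (max_card _) _.
    by rewrite card_prod -!cardsT -powersetT card_powerset cardsT card_ord mul2n -addnn expnD.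
  by rewrite lerXn2r ?nnegrE ?expR_ge0 ?expR_ge1Dx.
rewrite -expRM_natl -expRD ler_expR; lra.
Unshelve. all: by end_near.
Qed.

Lemma mvec_row_sum n (v : 'I_n -> R) t i (S : {set 'I_n}) B :
  (forall j, j \notin S -> v j = 0) ->
  mvec p B v i + t = row_sum p v t i (enum S) B.
Proof.
move=> vS; rewrite addrC /row_sum big_enum /= [in RHS]big_mkcond /=.
by congr (_ + _); apply: eq_bigr => j _; case: ifPn => // /vS ->; rewrite mulr0.
Qed.

(** For v supported on S, the row of i outside S uses only slots joining i to S. These blocks are
    disjoint for distinct i, so the rows are independent and the bound for one row is raised to a
    power. *)
Lemma gnp_expect_rows n (v : 'I_n -> R) t (S : {set 'I_n}) (a : R) :
  (forall j, j \notin S -> v j = 0) -> 0 <= a ->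
  32 * a * (t ^+ 2 + \sum_j v j ^+ 2) <= p * (1 - p) ->
  gnp_expect p (fun B => expR (- (a * \sum_(i in ~: S) (mvec p B v i + t) ^+ 2))) <=
  expR (- (a * (p * (1 - p)) * (t ^+ 2 + \sum_j v j ^+ 2) / 2)) ^+ #|~: S|.
Proof.
move=> vS a0 ha.
have Vs : \sum_(j <- enum S) v j ^+ 2 = \sum_j v j ^+ 2.
  rewrite big_enum [in LHS]big_mkcond /=; apply: eq_bigr => j _.
  by case: ifPn => // /vS ->; rewrite expr0n.
pose h i B := expR (- (a * row_sum p v t i (enum S) B ^+ 2)).
rewrite (_ : (fun B => _) = (fun B => \prod_(i <- enum (~: S)) h i B)); last first.
  apply/funext => B; rewrite -expR_sum big_enum /= sumrN -mulr_sumr.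
  by congr (expR (- (a * _))); apply: eq_bigr => i _; rewrite (mvec_row_sum t i B vS).
apply: (le_trans (@gnp_expect_blocks _ _ _ hp0 hp1 _ _ h
   (fun i => row_slots i (enum S))
   (fun=> expR (- (a * (p * (1 - p)) * (t ^+ 2 + \sum_j v j ^+ 2) / 2))) _ _ _ _ _)).
- exact: enum_uniq.
- by move=> *; apply: expR_ge0.
- move=> i; rewrite mem_enum inE => iS s /mapP[j]; rewrite mem_enum => jS ->.
  have ij : i != j by apply: contraNneq iS => ->.
  by rewrite inE cards2 ij.
- move=> i B; rewrite mem_enum inE => iS; rewrite -Vs.
  by apply: resamples_row_sum_expN; rewrite ?enum_uniq ?mem_enum ?Vs.
- move=> i j s; rewrite !mem_enum !inE => iS jS ij /mapP[k]; rewrite mem_enum => kS -> B.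
  have sj l : l \in enum S -> [set i; k] != [set j; l].
    rewrite mem_enum => lS; apply/eqP => e.
    have := set21 i k; rewrite e !inE (negPf ij) /= => /eqP il.
    by rewrite il lS in iS.
  by rewrite /h; have [-> ->] := row_sum_indep p v t sj B.
by rewrite big_enum /= prodr_const.
Qed.

Lemma lval_neq0 N (c : letter N) : (lval c : R) != 0 -> (0 < lsize c)%N.
Proof.
by case: c => a b; apply: contraNT; rewrite -eqn0Ngt addn_eq0 => /andP[/eqP /= e1 /eqP e2]; rewrite /lval /= e1 e2 subr0.
Qed.

Lemma card_support_word N n (k : word N n) :
  (#|[set i | lval (k i) != 0%R :> R]| <= wsize k)%N.
Proof.
rewrite -sum1_card big_mkcond; apply: leq_sum => i _; rewrite inE.
by case: ifP => // /lval_neq0.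
Qed.

(* Vectors with few and small integer coordinates are sparse, so the rows
   outside the support are independent, and there are too few such vectors for
   a union bound to beat the exponentially small failure probability. *)
Lemma gnp_aas_incompressible (T : R) :
  exists w beta : R, [/\ 0 < w, 0 < beta & forall (eta : R) (M : nat) (N : nat -> nat),
    gnp_aas p (fun n (G : sgraph n) => forall (k : word (N n) n) (c : letter M),
      let v i := eta / Num.sqrt n%:R * lval (k i) in let t := eta * lval c in
      (wsize k)%:R <= beta * n%:R -> 1 / 4 <= nrm v ^+ 2 <= 1 -> `|t| <= T ->
      w * n%:R < \sum_(i | lval (k i) == 0 :> R) (mvec p (val G) v i + t) ^+ 2)].
Proof.
pose sg := p * (1 - p).
have sg0 : 0 < sg by rewrite mulr_gt0// subr_gt0.
(* The largest exponent that the estimate for one row allows for all |t| <= T and |v| <= 1. *)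
pose a := sg / (32 * (T ^+ 2 + 1)).
have T1 : 0 < 32 * (T ^+ 2 + 1) by rewrite mulr_gt0// ltr_wpDl// sqr_ge0.
have a0 : 0 < a by rewrite divr_gt0.
have aT : 32 * a * (T ^+ 2 + 1) = sg.
  by rewrite /a; field; rewrite gt_eqF// ltr_wpDl// sqr_ge0.
(* Each row gains a sg / 8 because |v|^2 >= 1/4, and at least n/2 rows are available, which gives a
   sg n / 16. Half of it pays for the Markov threshold w n with w = sg / 32. *)
pose kap := a * sg / 32.
have kap0 : 0 < kap by rewrite divr_gt0// mulr_gt0.
(* With this q the factor (1 - q)^(-2n) of the word count is exp(kap n / 4). *)
pose q := 1 - expR (- (kap / 8)).
have k8 : 0 < kap / 8 by rewrite divr_gt0.
have q01 : 0 < q < 1.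
  rewrite /q subr_gt0 expR_lt1 oppr_lt0 k8 /= gtrDl oppr_lt0 expR_gt0//.
have tau0 : 0 < - ln q.
  by rewrite oppr_gt0 ln_lt0.
(* The bound 1/2 keeps at least n/2 rows outside the support. The other bound makes q^(-beta n) at
   most exp(kap n / 4), so there are at most exp(kap n / 2) words. *)
pose beta := Num.min (1 / 2) (kap / (4 * - ln q)).
have beta0 : 0 < beta by rewrite lt_min !divr_gt0// mulr_gt0.
have beta1 : beta <= 1 / 2 by rewrite ge_min lexx.
have beta2 : beta * - ln q <= kap / 4.
  apply: (@le_trans _ _ (kap / (4 * - ln q) * - ln q)).
    by rewrite ler_wpM2r ?(ltW tau0)// ge_min lexx orbT.
  by rewrite le_eqVlt; apply/orP; left; apply/eqP; field; rewrite lt_eqF// -oppr_gt0.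
exists (sg / 32), beta; split => //; first by rewrite divr_gt0.
move=> eta M N.
apply: (@gnp_aas_geometric _ _ hp0 hp1 _ #|letter M|%:R (expR (- (kap / 2)))).
  by rewrite expR_ge0 expR_lt1 oppr_lt0 divr_gt0.
near=> n.
pose v (k : word (N n) n) i : R := eta / Num.sqrt n%:R * lval (k i).
pose Q (kc : word (N n) n * letter M) :=
  [&& (wsize kc.1)%:R <= beta * n%:R, 1 / 4 <= nrm (v kc.1) ^+ 2 <= 1
    & `|eta * lval kc.2| <= T].
pose S (k : word (N n) n) := [set i | (lval (k i) : R) != 0].
pose F (kc : word (N n) n * letter M) (B : {set {set 'I_n}}) : R :=
  expR (a * (sg / 32 * n%:R)) *
  expR (- (a * \sum_(i in ~: S kc.1) (mvec p B (v kc.1) i + eta * lval kc.2) ^+ 2)).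
apply: le_trans; last apply: (@gnp_prob_ge _ _ hp0 hp1 n _ _ Q F); last first.
- move=> G nG; apply: contrapT => noF; apply: nG => k c v' t' h1 h2 h3.
  rewrite ltNge; apply/negP => h4; apply: noF; exists (k, c).
    by rewrite /Q h1 h2 h3.
  rewrite /F -expRD -[leLHS]expR0 ler_expR /= subr_ge0 ler_pM2l//.
  apply: le_trans h4; rewrite le_eqVlt; apply/orP; left; apply/eqP.
  by apply: eq_bigl => i; rewrite !inE negbK.
- by move=> *; rewrite mulr_ge0 ?expR_ge0.
rewrite lerD2l lerN2.
apply: (@le_trans _ _ (\sum_(kc | Q kc) expR (- kap * n%:R))).
  apply: ler_sum => -[k c] /and3P[/= kb /andP[V1 V2] cT].
  rewrite gnp_expectZ; rewrite sqr_nrm in V1 V2.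
  have vS j : j \notin S k -> v k j = 0.
    by rewrite inE negbK /v => /eqP ->; rewrite mulr0.
  have tT : (eta * lval c) ^+ 2 <= T ^+ 2.
    rewrite -(real_normK (num_real (eta * lval c))) lerXn2r ?nnegrE//.
    exact: le_trans cT.
  have hQ : 32 * a * ((eta * lval c) ^+ 2 + \sum_j v k j ^+ 2) <= sg.
    by rewrite -aT ler_wpM2l ?lerD// mulr_ge0// ltW.
  apply: le_trans (ler_wpM2l (expR_ge0 _) (gnp_expect_rows vS (ltW a0) hQ)) _.
  rewrite -expRM_natl -expRD ler_expR.
  have cS : n%:R / 2 <= #|~: S k|%:R :> R.
    have := cardsC (S k); rewrite card_ord => /(congr1 (fun m : nat => m%:R : R)).
    rewrite natrD.
    have : #|S k|%:R <= beta * n%:R by apply: le_trans kb; rewrite ler_nat card_support_word.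
    have : beta * n%:R <= 1 / 2 * n%:R by rewrite ler_wpM2r.
    lra.
  rewrite -/sg.
  have h1 : a * sg / 8 <= a * sg * ((eta * lval c) ^+ 2 + \sum_j v k j ^+ 2) / 2.
    have : a * sg * (1 / 4) <= a * sg * ((eta * lval c) ^+ 2 + \sum_j v k j ^+ 2).
      apply: ler_wpM2l; first by rewrite mulr_ge0 ?ltW.
      by apply: le_trans V1 _; rewrite lerDr sqr_ge0.
    lra.
  have h2 := ler_pM _ _ h1 cS.
  have ag0 : 0 < a * sg by rewrite mulr_gt0.
  have : a * sg / 8 * (n%:R / 2) <= #|~: S k|%:R *
      (a * sg * ((eta * lval c) ^+ 2 + \sum_j v k j ^+ 2) / 2).
    rewrite [leRHS]mulrC; apply: h2; last by rewrite divr_ge0.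
    by rewrite divr_ge0// ltW.
  rewrite /kap mulrN; lra.
rewrite sumr_const -[_ *+ _]mulr_natl.
pose D := Num.truncn (beta * n%:R).
pose A := [set k : word (N n) n | (wsize k <= D)%N].
have bn0 : 0 <= beta * n%:R by rewrite mulr_ge0// ltW.
have cA : #|A|%:R <= expR (kap / 2 * n%:R).
  apply: le_trans (@card_words _ _ _ _ q q01) _.
  have -> : 1 - q = expR (- (kap / 8)) by rewrite /q; ring.
  rewrite -!exprVn -expRN opprK -[q^-1]lnK; last by rewrite posrE invr_gt0; case/andP: q01.
  rewrite -!expRM_natl -expRD ler_expR lnV; last by rewrite posrE; case/andP: q01.
  have : D%:R * - ln q <= beta * n%:R * - ln q.
    by rewrite ler_wpM2r ?(ltW tau0)//; case/andP: (truncn_itv bn0).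
  have : beta * - ln q * n%:R <= kap / 4 * n%:R by rewrite ler_wpM2r.
  rewrite natrM; lra.
have cQ : (#|[pred kc | Q kc]| <= #|A| * #|letter M|)%N.
  rewrite -cardsT -cardsX -[#|[pred _ | _]|]cardsE subset_leq_card//.
  apply/fintype.subsetP => kc; rewrite !inE andbT => /and3P[kb _ _].
  by rewrite -ltnS -(ltr_nat R) (le_lt_trans kb)// truncnS_gt.
apply: (@le_trans _ _ (expR (kap / 2 * n%:R) * #|letter M|%:R * expR (- kap * n%:R))).
  rewrite ler_wpM2r ?expR_ge0//.
  apply: (@le_trans _ _ (#|A| * #|letter M|)%:R); first by rewrite ler_nat.
  by rewrite natrM ler_wpM2r.
rewrite mulrAC mulrC ler_wpM2l// -expRM_natl -expRD ler_expR; lra.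
Unshelve. all: by end_near.
Qed.

End UnionBounds.

(** * Sign sets of eigenvectors *)

Section Spectral.
Import mathcomp.boot.finset.
Context {R : realType} (p : R).
Implicit Types (C : R).

(** Test the bilinear form against y = M x. *)
Lemma nrm_mvec_le n (B : {set {set 'I_n}}) C x : 0 <= C -> opnorm_le p B C ->
  nrm (mvec p B x) <= C * nrm x.
Proof.
move=> C0 hC; have := hC (mvec p B x) x.
rewrite (_ : bil _ _ _ _ = nrm (mvec p B x) ^+ 2); last by rewrite sqr_nrm.
have [->|h0] := eqVneq (nrm (mvec p B x)) 0; first by rewrite mulr_ge0 ?nrm_ge0.
have hp : 0 < nrm (mvec p B x) by rewrite lt_neqAle eq_sym h0 nrm_ge0.
by rewrite expr2 -mulrA mulrCA ler_pM2l.
Qed.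

Lemma mvec_eigenvector n (G : sgraph n) (f : 'I_n -> R) (lam : R) :
  adjacency_mx (adj G) *m (\col_v f v) = lam *: \col_v f v ->
  mvec p (val G) f =1 fun i => (lam + p) * f i - p * \sum_j f j.
Proof.
move=> /matrixP e i; have := e i 0; rewrite !mxE => ei.
have -> : (lam + p) * f i - p * \sum_j f j = lam * f i - \sum_j p * (i != j)%:R * f j.
  rewrite mulrDl -addrA; congr (_ + _).
  rewrite (bigD1 i)//= [in RHS](bigD1 i)//= eqxx mulr0 mul0r add0r.
  rewrite mulrDr opprD addrA subrr add0r mulr_sumr; congr (- _).
  by apply: eq_bigr => j ji; rewrite eq_sym ji mulr1.
rewrite -ei -sumrB; apply: eq_bigr => j _; rewrite !mxE /dev /adj /=.
case: eqVneq => [<-|ij] /=; last by rewrite mulr1; ring.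
have -> : ([set i; i] \in val G) = false by
  apply: contraTF isT => /(fintype.subsetP (valP G)); rewrite inE setUid cards1.
by rewrite mulr0 !mul0r subrr.
Qed.

Lemma count_le_nrm n (g : 'I_n -> R) (P : pred 'I_n) (c : R) (K : nat) :
  (forall i, P i -> 1 <= `|g i|) -> nrm g <= c -> c ^+ 2 <= K%:R ->
  (#|[set i | P i]| <= K)%N.
Proof.
move=> Pg gc cK; rewrite -(ler_nat R); apply: le_trans cK.
apply: (@le_trans _ _ (nrm g ^+ 2)); last first.
  by rewrite lerXn2r ?nnegrE ?nrm_ge0// (le_trans (nrm_ge0 _) gc).
rewrite sqr_nrm -sum1_card natr_sum big_mkcond; apply: ler_sum => i _.
rewrite inE; case: ifPn => [/Pg h|_]; last exact: sqr_ge0.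
by rewrite -(real_normK (num_real (g i))) exprn_ege1.
Qed.

Lemma top_eigenvector_sign n (B : {set {set 'I_n}}) (f : 'I_n -> R) C (mu s : R) (K : nat) :
  0 < p -> (0 < n)%N -> 0 <= C -> opnorm_le p B (C * Num.sqrt n%:R) ->
  C * Num.sqrt n%:R <= p * n%:R / 4 -> p * n%:R / 2 < `|mu| ->
  (4 * C / p) ^+ 2 <= K%:R -> nrm f != 0 ->
  mvec p B f =1 (fun i => mu * f i - p * s) ->
  (#|[set i | (f i <= 0)%R]| <= K)%N \/ (#|[set i | (0 <= f i)%R]| <= K)%N.
Proof.
move=> p0 n0 C0 hC hn hmu hK f0 e.
have s0 : 0 <= Num.sqrt n%:R :> R by exact: sqrtr_ge0.
have n0' : 0 < n%:R :> R by rewrite ltr0n.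
have pn0 : 0 < p * n%:R by rewrite mulr_gt0.
have ss : Num.sqrt n%:R * Num.sqrt n%:R = n%:R :> R by rewrite -expr2 sqr_sqrtr.
have C0' : 0 <= C * Num.sqrt n%:R by rewrite mulr_ge0.
have mu0 : mu != 0 by rewrite -normr_gt0; lra.
(* If s = 0 then f is an eigenvector of M itself, with |mu| > |M|, which is impossible. *)
have [sz|sz] := eqVneq s 0.
  have := nrm_mvec_le f C0' hC.
  rewrite (eq_nrm (y := fun i => mu * f i)) => [|i]; last by rewrite e sz mulr0 subr0.
  by rewrite nrmZ ler_pM2r; [lra | rewrite lt_neqAle eq_sym f0 nrm_ge0].
(* Normalised so that c f = 1 + g with mu g = M(1 + g). As |M| <= pn/4 while |mu| > pn/2, this
   forces |g| <= 4C/p; wherever c f <= 0 one has g <= -1, which happens at most |g|^2 times. *)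
pose c := mu / (p * s).
have ps : p * s != 0 by rewrite mulf_neq0// gt_eqF.
pose g i := c * f i - 1.
have gm : (fun i => mu * g i) =1 mvec p B (fun i => 1 + g i).
  move=> i; rewrite (@eq_mvec _ p _ B _ (fun i => c * f i)); last by move=> j; rewrite /g; ring.
  rewrite mvecZ e /g /c; field.
  by rewrite sz gt_eqF.
have hg : nrm g <= 4 * C / p.
  have := nrm_mvec_le (fun i => 1 + g i) C0' hC.
  rewrite -(eq_nrm gm) nrmZ => h1.
  have h2 := nrmD (fun=> 1) g; rewrite nrm_cst normr1 mulr1 card_ord in h2.
  have h3 := le_trans h1 (ler_wpM2l C0' h2).
  have h4 : (p * n%:R / 2) * nrm g <= `|mu| * nrm g by rewrite ler_wpM2r ?nrm_ge0// ltW.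
  have h5 : C * Num.sqrt n%:R * nrm g <= p * n%:R / 4 * nrm g by rewrite ler_wpM2r ?nrm_ge0.
  have h6 : C * Num.sqrt n%:R * Num.sqrt n%:R = C * n%:R by rewrite -mulrA ss.
  rewrite ler_pdivlMr// -(ler_pM2r n0').
  rewrite mulrDr h6 in h3; lra.
have [c0|c0] := lerP 0 c; [left|right]; apply: (count_le_nrm _ hg hK) => i fi.
  have := mulr_ge0_le0 c0 fi; rewrite /g => cf.
  by rewrite ler0_norm; lra.
have := mulr_le0_ge0 (ltW c0) fi; rewrite /g => cf.
by rewrite ler0_norm; lra.
Qed.

(** Summing the equation over all coordinates gives (mu - pn) s, which is O(n) because |M f| =
    O(sqrt n), while |mu - pn| >= pn/2. The bound on s fed back into the equation bounds mu. *)
Lemma bulk_bounds n (B : {set {set 'I_n}}) (f : 'I_n -> R) C (mu : R) :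
  0 < p -> (0 < n)%N -> 0 <= C -> opnorm_le p B (C * Num.sqrt n%:R) ->
  `|mu| <= p * n%:R / 2 -> nrm f = 1 ->
  mvec p B f =1 (fun i => mu * f i - p * \sum_j f j) ->
  p * `|\sum_j f j| <= 2 * C /\ `|mu| <= 3 * C * Num.sqrt n%:R.
Proof.
move=> p0 n0 C0 hC hmu f1 e.
have s0 : 0 <= Num.sqrt n%:R :> R by exact: sqrtr_ge0.
have n0' : 0 < n%:R :> R by rewrite ltr0n.
have ss : Num.sqrt n%:R * Num.sqrt n%:R = n%:R :> R by rewrite -expr2 sqr_sqrtr.
have C0' : 0 <= C * Num.sqrt n%:R by rewrite mulr_ge0.
have hM := nrm_mvec_le f C0' hC; rewrite f1 mulr1 in hM.
set s := \sum_j f j in e *.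
have h1 : `|\sum_i mvec p B f i| <= C * n%:R.
  apply: le_trans (ler_norm_sum _ _ _) _; apply: le_trans (sum_norm_le predT _) _.
  rewrite cardT size_enum_ord; apply: le_trans (ler_wpM2l s0 hM) _.
  by rewrite mulrCA ss.
have h2 : \sum_i mvec p B f i = (mu - p * n%:R) * s.
  under eq_bigr do rewrite e.
  by rewrite sumrB -mulr_sumr -/s sumr_const card_ord -[_ *+ n]mulr_natl; ring.
have h3 : p * n%:R / 2 <= `|mu - p * n%:R|.
  have pn0 : 0 < p * n%:R by rewrite mulr_gt0.
  by rewrite ler0_norm; have := ler_norm mu; lra.
have hs : p * `|s| <= 2 * C.
  rewrite h2 normrM in h1.
  have := le_trans (ler_wpM2r (normr_ge0 s) h3) h1.
  rewrite (_ : _ * `|s| = p * `|s| / 2 * n%:R); last by ring.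
  by rewrite ler_pM2r//; lra.
split => //.
have : nrm (fun i => mu * f i) <= C * Num.sqrt n%:R + Num.sqrt n%:R * (p * `|s|).
  rewrite (eq_nrm (y := fun i => mvec p B f i + p * s)); last by move=> i; rewrite e subrK.
  apply: le_trans (nrmD _ _) _; apply: lerD => //.
  by rewrite nrm_cst card_ord normrM (gtr0_norm p0).
rewrite nrmZ f1 mulr1.
have := ler_wpM2l s0 hs; lra.
Qed.

(** A deterministic statement: the incompressibility of the graph enters as a hypothesis, and a
    vector with too few positive entries is rounded to one that contradicts it. *)
Lemma bulk_positive_mass n (B : {set {set 'I_n}}) (f : 'I_n -> R) C
    (mu w beta eta gam : R) (N M : nat) :
  0 < p -> (0 < n)%N -> 0 <= C -> opnorm_le p B (C * Num.sqrt n%:R) ->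
  (forall (k : word N n) (c : letter M),
      let v i := eta / Num.sqrt n%:R * lval (k i) in let t := eta * lval c in
      (wsize k)%:R <= beta * n%:R -> 1 / 4 <= nrm v ^+ 2 <= 1 -> `|t| <= 2 * C ->
      w * n%:R < \sum_(i | lval (k i) == 0 :> R) (mvec p B v i + t) ^+ 2) ->
  0 < eta -> eta <= 1 / 2 -> (eta * (4 * C + 1)) ^+ 2 <= w -> 0 < beta ->
  Num.sqrt n%:R / eta <= N%:R -> 2 * C / eta <= M%:R ->
  gam = (beta * eta / 4) ^+ 2 -> 4 * C / p <= beta * eta * Num.sqrt n%:R ->
  `|mu| <= p * n%:R / 2 -> nrm f = 1 ->
  mvec p B f =1 (fun i => mu * f i - p * \sum_j f j) ->
  gam * n%:R <= #|[set i | 0 < f i]|%:R.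
Proof.
move=> p0 n0 C0 hC hinc eta0 eta1 hw beta0 hN hM hgam hn hmu f1 e.
rewrite leNgt; apply/negP => hV.
have s0 : 0 < Num.sqrt n%:R :> R by rewrite sqrtr_gt0 ltr0n.
have C0' : 0 <= C * Num.sqrt n%:R by rewrite mulr_ge0// ltW.
have [hs hmu'] := bulk_bounds p0 n0 C0 hC hmu f1 e.
set s := \sum_j f j in e hs.
(* The l1 norm is twice the positive mass minus s. Cauchy-Schwarz on fewer than gam n vertices
   bounds the first term by half of the target, which fixes [gam]; the lower bound on sqrt n leaves
   the other half for s. *)
have l1 : \sum_i `|f i| <= beta * eta * Num.sqrt n%:R.
  have -> : \sum_i `|f i| = 2 * \sum_(i | 0 < f i) `|f i| - s.
    rewrite /s (bigID (fun i => 0 < f i)) /= (bigID (fun i => 0 < f i) predT f) /=.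
    rewrite (eq_bigr (fun i => f i)) => [|i fi]; last by rewrite gtr0_norm.
    rewrite [X in _ + X = _](eq_bigr (fun i => - f i)) => [|i]; last first.
      by rewrite -leNgt => fi; rewrite ler0_norm.
    rewrite sumrN; ring.
  have := sum_norm_le [pred i | 0 < f i] f; rewrite f1 mulr1 /= => hp.
  have hcard : Num.sqrt #|[pred i | 0 < f i]|%:R <= beta * eta / 4 * Num.sqrt n%:R.
    have be0 : 0 <= beta * eta / 4 by rewrite divr_ge0 ?mulr_ge0 ?ltW.
    rewrite -[beta * eta / 4](ger0_norm be0) -sqrtr_sqr -sqrtrM ?sqr_ge0// -hgam.
    by rewrite ler_wsqrtr// ltW//; move: hV; rewrite cardsE.
  have hs' : - s <= 2 * C / p.
    by rewrite ler_pdivlMr// mulrC; have := ler_norm (- s); rewrite normrN; nra.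
  have -> : beta * eta * Num.sqrt n%:R = 2 * (beta * eta / 4 * Num.sqrt n%:R) +
    beta * eta * Num.sqrt n%:R / 2 by field.
  have := le_trans hp hcard; lra.
have es : eta * (Num.sqrt n%:R / eta) = Num.sqrt n%:R by rewrite mulrC divfK ?gt_eqF.
have se0 : 0 < Num.sqrt n%:R / eta by rewrite divr_gt0.
(* Rounding x to integers rounds f to multiples of eta / sqrt n, at a cost of at most eta in norm.
   Since eta <= 1/2 the rounded vector keeps norm between 1/2 and 1. *)
pose x i := Num.sqrt n%:R / eta * f i.
have xN i : `|x i| <= N%:R.
  apply: le_trans hN; rewrite normrM (gtr0_norm se0) ler_piMr ?(ltW se0)// -f1.
  exact: ler_nrm.
have tM : `|p * s / eta| <= M%:R.
  apply: le_trans hM; rewrite normrM normfV (gtr0_norm eta0) ler_pM2r ?invr_gt0//.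
  by rewrite normrM (gtr0_norm p0).
pose k := trunc_word N x; pose c := trunc_letter M (p * s / eta).
have [c1 c2 _] := trunc_letterP tM.
pose v i := eta / Num.sqrt n%:R * lval (k i).
pose r i := f i - v i.
have fx i : f i = eta / Num.sqrt n%:R * x i by rewrite /x; field; rewrite !gt_eqF.
have es0 : 0 < eta / Num.sqrt n%:R by rewrite divr_gt0.
have hr i : `|r i| <= eta / Num.sqrt n%:R.
  rewrite /r /v fx -mulrBr normrM (gtr0_norm es0) ler_piMr ?(ltW es0)// ffunE.
  by case: (trunc_letterP (xN i)).
have nr : nrm r <= eta.
  apply: le_trans (nrm_bounded hr) _; rewrite card_ord mulrC divfK ?gt_eqF//.
have nv1 : nrm v <= 1.
  rewrite -f1; apply: nrm_mono => i; rewrite fx /v 2!(normrM (eta / _)) (gtr0_norm es0) ler_pM2l// ffunE.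
  by case: (trunc_letterP (xN i)).
have nv2 : 1 / 2 <= nrm v.
  have := nrmD v r; rewrite (eq_nrm (y := f)) ?f1 => [|i]; last by rewrite /r addrC subrK.
  lra.
have fvr : f =1 fun i => v i + r i by move=> i; rewrite /r addrC subrK.
pose t := eta * lval c.
have ht : `|t| <= 2 * C.
  apply: le_trans hs; rewrite /t normrM (gtr0_norm eta0).
  apply: le_trans (ler_wpM2l (ltW eta0) c2) _.
  by rewrite normrM normfV (gtr0_norm eta0) mulrC divfK ?gt_eqF// normrM (gtr0_norm p0).
have ht' : `|t - p * s| <= eta.
  rewrite /t (_ : _ - _ = - (eta * (p * s / eta - lval c))); last by field; rewrite gt_eqF.
  by rewrite normrN normrM (gtr0_norm eta0) ler_piMr// ltW.
(* Where v vanishes f equals r, and there the equation for f says that M v + t is exactly u. The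
   three terms of u have norms at most 3C, 1 and C times eta sqrt n. *)
pose u i := mu * r i + (t - p * s) + - 1 * mvec p B r i.
have hu : nrm u <= eta * (4 * C + 1) * Num.sqrt n%:R.
  apply: le_trans (nrmD _ _) _; rewrite nrmZ normrN1 mul1r.
  apply: le_trans (lerD (nrmD _ _) (nrm_mvec_le r C0' hC)) _.
  rewrite nrmZ nrm_cst card_ord.
  have h1 : `|mu| * nrm r <= 3 * C * Num.sqrt n%:R * eta by rewrite ler_pM ?nrm_ge0.
  have h2 := ler_wpM2l (ltW s0) ht'.
  have h3 := ler_wpM2l C0' nr.
  lra.
suff : \sum_(i | lval (k i) == 0 :> R) (mvec p B v i + t) ^+ 2 <= w * n%:R.
  rewrite leNgt => /negP; apply; apply: hinc => //.
    apply: le_trans (wsize_trunc xN) _; rewrite /x.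
    under eq_bigr do rewrite normrM (gtr0_norm se0).
    rewrite -mulr_sumr; apply: le_trans (ler_wpM2l (ltW se0) l1) _.
    rewrite [leLHS](_ : _ = beta * (Num.sqrt n%:R ^+ 2)); last by field; rewrite gt_eqF.
    by rewrite sqr_sqrtr.
  by rewrite -/v; apply/andP; split; nra.
apply: (@le_trans _ _ (nrm u ^+ 2)).
  rewrite sqr_nrm big_mkcond; apply: ler_sum => i _.
  case: ifPn => [/eqP ki|_]; last exact: sqr_ge0.
  have vi : v i = 0 by rewrite /v ki mulr0.
  have ri : r i = f i by rewrite /r vi subr0.
  suff -> : mvec p B v i + t = u i by [].
  have := e i; rewrite (@eq_mvec _ p _ B _ _ fvr) (mvecD p B v r) /u ri; lra.
apply: (@le_trans _ _ ((eta * (4 * C + 1) * Num.sqrt n%:R) ^+ 2)).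
  by rewrite lerXn2r ?nnegrE ?nrm_ge0// (le_trans (nrm_ge0 _) hu).
by rewrite exprMn sqr_sqrtr// ler_wpM2r.
Qed.

End Spectral.

(** * Components and nodal domains *)

Section Components.
Import mathcomp.boot.fintype mathcomp.boot.finset.
Context {T : finType} (e : rel T) (esym : symmetric e).
Implicit Types X Y D E S U W : {set T}.

(** For [Y] inside [X]: [Y] is a union of components of the graph induced on [X]. *)
Definition closed_in X Y : bool :=
  [forall x in Y, forall y in X, e x y ==> (y \in Y)].

Lemma closed_inP X Y :
  reflect (forall x y, x \in Y -> y \in X -> e x y -> y \in Y) (closed_in X Y).
Proof.
apply: (iffP idP) => [/forall_inP h x y xY yX|h].
  by have /forall_inP/(_ y yX)/implyP := h x xY.
by apply/forall_inP => x xY; apply/forall_inP => y yX; apply/implyP; apply: h.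
Qed.

Lemma closed_in_path X Y x s : closed_in X Y -> x \in Y ->
  path [rel u v in X | e u v] x s -> path [rel u v in Y | e u v] x s /\ last x s \in Y.
Proof.
move=> /closed_inP cl; elim: s x => //= y s IH x xY /andP[/andP[/andP[xX yX] xy] ys].
by have yY := cl x y xY yX xy; rewrite xY yY xy; apply: IH.
Qed.

Lemma connected_sub_closed X Y E x : closed_in X Y -> E \subset X ->
  connected_in e E -> x \in E -> x \in Y -> E \subset Y.
Proof.
move=> cl EX /forall_inP cE xE xY; apply/subsetP => y yE.
have /forall_inP/(_ y yE)/connectP[s sE ->] := cE x xE.
have sX : path [rel u v in X | e u v] x s.
  apply: sub_path sE => u v /= /andP[/andP[uE vE] ->].
  by rewrite !(subsetP EX).
by case: (closed_in_path cl xY sX).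
Qed.

Definition component X x : {set T} := [set y in X | connect [rel u v in X | e u v] x y].

Lemma in_rel_sym X : connect_sym [rel u v in X | e u v].
Proof.
by apply: sym_connect_sym => u v /=; rewrite esym [(u \in X) && _]andbC.
Qed.

Lemma component_closed X x : closed_in X (component X x).
Proof.
apply/closed_inP => y z; rewrite !inE => /andP[yX xy] zX yz; rewrite zX /=.
by apply: connect_trans xy (connect1 _); rewrite /= yX zX.
Qed.

Lemma component_connected X x : x \in X -> connected_in e (component X x).
Proof.
move=> xX; have xD : x \in component X x by rewrite inE xX connect0.
have h y : y \in component X x -> connect [rel u v in component X x | e u v] x y.
  rewrite inE => /andP[_ /connectP[s sX ys]]; apply/connectP; exists s => //.
  by case: (closed_in_path (component_closed X x) xD sX).
apply/forall_inP => y yD; apply/forall_inP => z zD.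
by apply: connect_trans (h z zD); rewrite in_rel_sym h.
Qed.

(** A closed subset of X with at least m vertices misses fewer than K of them, by the edge property.
    Take a smallest such Y and a component D in it: Y minus D is closed and smaller, so it has fewer
    than m vertices. If D also had fewer than m, then X would have fewer than m + m + K <= 3m. *)
Lemma giant_component (K m : nat) X : (K <= m)%N -> (0 < m)%N ->
  (forall U W, [disjoint U & W] -> (K <= #|U|)%N -> (m <= #|W|)%N ->
     exists u w, [/\ u \in U, w \in W & e u w]) ->
  (3 * m <= #|X|)%N ->
  exists D, [/\ D \subset X, connected_in e D, closed_in X D & (#|X :\: D| < K)%N].
Proof.
move=> Km m0 edge mX.
have noedge Y : closed_in X Y -> Y \subset X -> (m <= #|Y|)%N -> (#|X :\: Y| < K)%N.
  move=> /closed_inP cl YX mY; rewrite ltnNge; apply/negP => KY.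
  have [|u [w []]] := edge _ _ _ KY mY; first by rewrite disjoints_subset setDE subsetIr.
  rewrite inE => /andP[uY uX] wY; rewrite esym => wu.
  by rewrite (cl w u wY uX wu) in uY.
pose P Y := [&& Y \subset X, closed_in X Y & (m <= #|Y|)%N].
have PX : P X.
  rewrite /P subxx /= (leq_trans _ mX) ?leq_pmull// andbT.
  by apply/closed_inP.
case: (@arg_minnP _ X P (fun Y => #|Y|) PX) => Y /and3P[YX clY mY] minY.
have [x xY] : exists x, x \in Y by apply/set0Pn; rewrite -card_gt0 (leq_trans m0).
have xX := subsetP YX _ xY.
have DY : component X x \subset Y.
  apply: (connected_sub_closed clY _ (component_connected xX) _ xY).
    by apply/subsetP => y; rewrite inE => /andP[].
  by rewrite inE xX connect0.
have YDm : (#|Y :\: component X x| < m)%N.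
  rewrite ltnNge; apply/negP => h.
  have : P (Y :\: component X x).
    rewrite /P h andbT (subset_trans (subsetDl _ _) YX) /=.
    apply/closed_inP => u w; rewrite inE => /andP[uD uY] wX uw.
    rewrite inE (closed_inP _ _ clY u w) // andbT.
    apply: contra uD => wD; apply: (closed_inP _ _ (component_closed X x) w) => //.
      exact: subsetP uY.
    by rewrite esym.
  move/minY; rewrite leqNgt => /negP; apply.
  rewrite -(cardsID (component X x) Y) -[X in (X < _)%N]add0n ltn_add2r card_gt0.
  by apply/set0Pn; exists x; rewrite !inE xY xX connect0.
have DX := subset_trans DY YX.
exists (component X x); split => //; first exact: component_connected.
  exact: component_closed.
have [mD|Dm] := leqP m #|component X x|; first exact: noedge (component_closed X x) DX mD.
have := noedge Y clY YX mY.
have := cardsID Y X; have := cardsID (component X x) Y.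
rewrite (setIidPr DY) (setIidPr YX) => h1 h2 h3.
have : (#|X| < 3 * m)%N by rewrite -h2 -h1; lia.
by rewrite ltnNge mX.
Qed.

(** Only [Dp] and [Dn] can have more than L vertices. Hence every admissible choice of S, however
    ties are broken, contains each of them that is nonempty. *)
Lemma two_largest_cover (F S : {set {set T}}) (Xp Xn Dp Dn : {set T}) (L : nat) :
  (Dp = set0 \/ Dp \in F /\ (L < #|Dp|)%N) ->
  (Dn = set0 \/ Dn \in F /\ (L < #|Dn|)%N) ->
  (#|Xp :\: Dp| <= L)%N -> (#|Xn :\: Dn| <= L)%N ->
  (forall E, E \in F -> [\/ E = Dp, E = Dn, E \subset Xp :\: Dp | E \subset Xn :\: Dn]) ->
  two_largest F S -> (#|(Xp :|: Xn) :\: cover S| <= 2 * L)%N.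
Proof.
move=> hp hn Lp Ln hF [SF cS large].
have big E : E \in F -> (L < #|E|)%N -> E = Dp \/ E = Dn.
  move=> EF LE; case: (hF E EF) => [->|->|EX|EX]; [by left|by right| |].
    by have := leq_trans (subset_leq_card EX) Lp; rewrite leqNgt LE.
  by have := leq_trans (subset_leq_card EX) Ln; rewrite leqNgt LE.
(* If a big D were left out, every member of S would be at least as large and so equal to D'. Then S
   has at most one member, which by its prescribed size means S = F. *)
have inS D D' : (forall E, E \in F -> (L < #|E|)%N -> E = D \/ E = D') ->
    D \in F -> (L < #|D|)%N -> D \in S.
  move=> bigD DF LD; apply: contraT => DS.
  have S1 : S \subset [set D'].
    apply/subsetP => A AS; rewrite inE.
    have AF := subsetP SF _ AS.
    have LA : (L < #|A|)%N by apply: leq_trans LD (large A D AS _); rewrite inE DS.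
    case: (bigD A AF LA) => AD; last by rewrite AD.
    by rewrite AD (negPf DS) in AS.
  have : (#|S| <= 1)%N by rewrite -(cards1 D') subset_leq_card.
  rewrite cS geq_min /= => F1.
  have SE : S = F.
    by apply/eqP; rewrite eqEcard SF cS leq_min leqnn andbT (leq_trans F1).
  by rewrite SE DF in DS.
have cov D : D \in S -> D \subset cover S by move=> DS; apply: (bigcup_sup D).
have pS : Dp \subset cover S.
  case: hp => [->|[DF LD]]; first exact: sub0set.
  exact/cov/(inS Dp Dn).
have nS : Dn \subset cover S.
  case: hn => [->|[DF LD]]; first exact: sub0set.
  by apply/cov/(inS Dn Dp) => // E EF LE; case: (big E EF LE); [right|left].
apply: (@leq_trans #|(Xp :\: Dp) :|: (Xn :\: Dn)|).
  rewrite subset_leq_card// setDUl setUSS// setDS//.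
by rewrite mul2n -addnn (leq_trans (leq_card_setU _ _))// leq_add.
Qed.

(** A domain other than the two giants is a subset of one of two bounded leftover sets, so counting
    subsets suffices. *)
Lemma card_le_two_and_subsets (F : {set {set T}}) (Yp Yn Dp Dn : {set T}) (L : nat) :
  (#|Yp| <= L)%N -> (#|Yn| <= L)%N ->
  (forall E, E \in F -> [\/ E = Dp, E = Dn, E \subset Yp | E \subset Yn]) ->
  (#|F| <= 2 + 2 * 2 ^ L)%N.
Proof.
move=> Lp Ln hF.
apply: (@leq_trans #|[set Dp; Dn] :|: (powerset Yp :|: powerset Yn)|).
  apply: subset_leq_card; apply/subsetP => E /hF[->|->|h|h]; rewrite !inE ?eqxx ?h ?orbT//.
apply: leq_trans (leq_card_setU _ _) _; apply: leq_add.
  by rewrite cards2; case: (_ != _).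
apply: leq_trans (leq_card_setU _ _) _.
by rewrite mul2n -addnn leq_add// card_powerset leq_exp2l.
Qed.

(* [Xp] and [Xn] are the nonnegative and nonpositive (or positive and negative)
   sets of a function, so [F] is its family of weak (or strong) nodal domains. *)
Lemma nodal_domains_structure (K K0 m : nat) (adm : pred {set T}) (Xp Xn : {set T}) :
  (K + K0 < m)%N ->
  (forall U W, [disjoint U & W] -> (K <= #|U|)%N -> (m <= #|W|)%N ->
     exists u w, [/\ u \in U, w \in W & e u w]) ->
  (forall E, adm E = connected_in e E && ((E \subset Xp) || (E \subset Xn))) ->
  (3 * m <= #|Xp :\: Xn|)%N \/ (#|Xp| <= K0)%N ->
  (3 * m <= #|Xn :\: Xp|)%N \/ (#|Xn| <= K0)%N ->
  let F := [set D | maxset adm D] in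
  (forall S : {set {set T}}, two_largest F S -> (#|(Xp :|: Xn) :\: cover S| <= 2 * (K + K0))%N) /\
  (#|F| <= 2 + 2 * 2 ^ (K + K0))%N.
Proof.
move=> Km edge admE hp hn F.
have giant X X' : (forall E, adm E = connected_in e E && ((E \subset X) || (E \subset X'))) ->
    (3 * m <= #|X :\: X'|)%N \/ (#|X| <= K0)%N ->
    exists D, [/\ D = set0 \/ D \in F /\ (K + K0 < #|D|)%N, (#|X :\: D| <= K + K0)%N &
      forall E, E \in F -> E \subset X -> E = D \/ E \subset X :\: D].
  move=> aE [mX|XK]; last first.
    exists set0; split; [by left | | by move=> E _ EX; right; rewrite setD0].
    by rewrite setD0 (leq_trans XK)// leq_addl.
  have mX' : (3 * m <= #|X|)%N := leq_trans mX (subset_leq_card (subsetDl _ _)).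
  have Km' : (K <= m)%N by lia.
  have [|D [DX cD clD KD]] := giant_component Km' _ edge mX'; first by lia.
  (* A set containing D could otherwise be admissible through X' instead of X, as the two may share
     the zeros of f. Since D misses fewer than K vertices of X, it meets X outside X', and
     closedness in X then gives maximality. *)
  have notX' : ~~ (D \subset X').
    apply: contraL mX => DX'; rewrite -ltnNge.
    apply: leq_ltn_trans (subset_leq_card (setDS _ DX')) _; lia.
  have LD : (K + K0 < #|D|)%N.
    by have := cardsID D X; rewrite (setIidPr DX) => h; lia.
  have [x xD] : exists x, x \in D by apply/set0Pn; rewrite -card_gt0 (leq_ltn_trans _ LD).
  exists D; split.
  - right; split => //; rewrite inE; apply/maxsetP; split.
      by rewrite aE cD DX.
    move=> E; rewrite aE => /andP[cE /orP[EX|EX']] DE; last first.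
      by rewrite (subset_trans DE EX') in notX'.
    apply/eqP; rewrite eqEsubset DE andbT.
    exact: connected_sub_closed clD EX cE (subsetP DE _ xD) xD.
  - by rewrite (leq_trans (ltnW KD))// leq_addr.
  - move=> E; rewrite inE => /maxsetP[]; rewrite aE => /andP[cE _] maxE EX.
    have [/pred0Pn[y /andP[yE yD]]|dED] := boolP (~~ [disjoint E & D]).
      left; symmetry; apply: maxE; first by rewrite aE cD DX.
      exact: connected_sub_closed clD EX cE yE yD.
    by right; rewrite subsetD EX; rewrite negbK in dED.
have [Dp [p1 p2 p3]] := giant Xp Xn admE hp.
have [Dn [n1 n2 n3]] := giant Xn Xp (fun E => etrans (admE E) (congr1 _ (orbC _ _))) hn.
have hF E : E \in F -> [\/ E = Dp, E = Dn, E \subset Xp :\: Dp | E \subset Xn :\: Dn].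
  move=> EF; have := EF; rewrite inE => /maxsetP[]; rewrite admE => /andP[_ /orP[EX|EX]] _.
    by case: (p3 E EF EX) => h; [constructor 1|constructor 3].
  by case: (n3 E EF EX) => h; [constructor 2|constructor 4].
split; first by move=> S; apply: two_largest_cover p1 n1 p2 n2 hF.
exact: card_le_two_and_subsets p2 n2 hF.
Qed.

End Components.

(** * Sign conditions as inclusions in sign sets *)

Section SignSets.
Import mathcomp.boot.fintype mathcomp.boot.finset.
Context {R : realType} {T : finType}.

Lemma weak_sign_sets (f : T -> R) (B : {set T}) :
  [forall x in B, forall y in B, 0 <= f x * f y] =
  (B \subset [set x | 0 <= f x]) || (B \subset [set x | f x <= 0]).
Proof.
apply/idP/orP.
  move=> /forall_inP h; apply/orP; rewrite -implyNb; apply/implyP => /subsetPn[x xB].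
  rewrite inE -ltNge => fx; apply/subsetP => y yB; rewrite inE.
  by have /forall_inP/(_ y yB) := h x xB; rewrite nmulr_rge0.
by case=> /subsetP h; apply/forall_inP => x /h; rewrite inE => fx;
  apply/forall_inP => y /h; rewrite inE => fy; [rewrite mulr_ge0|rewrite mulr_le0].
Qed.

Lemma strong_sign_sets (f : T -> R) (B : {set T}) :
  [forall x in B, forall y in B, 0 < f x * f y] =
  (B \subset [set x | 0 < f x]) || (B \subset [set x | f x < 0]).
Proof.
apply/idP/orP.
  move=> /forall_inP h; apply/orP; rewrite -implyNb; apply/implyP => /subsetPn[x xB].
  rewrite inE -leNgt => fx; apply/subsetP => y yB; rewrite inE.
  have fx0 : f x < 0.
    rewrite lt_neqAle fx andbT; apply/eqP => f0.
    by have /forall_inP/(_ x xB) := h x xB; rewrite f0 mul0r ltxx.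
  by have /forall_inP/(_ y yB) := h x xB; rewrite nmulr_rgt0.
by case=> /subsetP h; apply/forall_inP => x /h; rewrite inE => fx;
  apply/forall_inP => y /h; rewrite inE => fy; [rewrite mulr_gt0|rewrite nmulr_rgt0].
Qed.

End SignSets.

(** * Sign patterns of the eigenvectors of G(n,p) *)

Section EigenvectorSigns.
Import mathcomp.boot.fintype mathcomp.boot.finset.
Context {R : realType} (p : R) (hp0 : 0 < p) (hp1 : p < 1).

Lemma near_sqrtn_ge (c : R) : (\forall n \near \oo, c <= Num.sqrt n%:R)%classic.
Proof.
near=> n; apply: le_trans (ler_norm c) _; rewrite -sqrtr_sqr ler_wsqrtr//.
by near: n; apply: nbhs_infty_ger.
Unshelve. all: by end_near.
Qed.

(** The first two alternatives come from |lam + p| > pn/2, the third from the remaining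
    eigenvalues. *)
Lemma gnp_aas_eigenvector_signs : exists (K0 : nat) (gam : R), 0 < gam /\
  gnp_aas p (fun n (G : sgraph n) => forall f : 'I_n -> R,
    eigenvector (adjacency_mx (adj G)) (\col_v f v) ->
    [\/ (#|[set i | (f i <= 0)%R]| <= K0)%N, (#|[set i | (0 <= f i)%R]| <= K0)%N
      | gam * n%:R <= #|[set i | 0 < f i]|%:R /\ gam * n%:R <= #|[set i | f i < 0]|%:R]).
Proof.
pose C : R := 130.
have [w [beta [w0 beta0 hinc]]] := gnp_aas_incompressible hp0 hp1 (2 * C).
pose K0 := (Num.truncn ((4 * C / p) ^+ 2)).+1.
have C41 : 0 < 4 * C + 1 by rewrite /C; lra.
(* Fine enough that the defect caused by rounding, of squared norm at most (eta (4C + 1))^2 n, stays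
   within w n. *)
pose eta := Num.min (1 / 2) (Num.sqrt w / (4 * C + 1)).
have eta0 : 0 < eta by rewrite lt_min !divr_gt0// sqrtr_gt0.
have eta1 : eta <= 1 / 2 by rewrite ge_min lexx.
have hw : (eta * (4 * C + 1)) ^+ 2 <= w.
  rewrite -[leRHS](sqr_sqrtr (ltW w0)) lerXn2r ?nnegrE ?sqrtr_ge0 ?mulr_ge0 ?(ltW eta0) ?(ltW C41)//.
  by rewrite -ler_pdivlMr// ge_min lexx orbT.
pose gam := (beta * eta / 4) ^+ 2.
exists K0, gam; split; first by rewrite exprn_gt0// divr_gt0// mulr_gt0.
(* Alphabet sizes large enough for truncation to be exact rounding. The one for the shift does not
   depend on n, so the shift adds only a constant factor to the union bound. *)
pose N n := (Num.truncn (Num.sqrt n%:R / eta : R)).+1.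
pose M := (Num.truncn (2 * C / eta)).+1.
apply: gnp_aas_sub (gnp_aas_and hp0 hp1 (gnp_aas_opnorm hp0 hp1) (hinc eta M N)) => //.
near=> n.
have n0 : (0 < n)%N by near: n; exists 1%N.
have h1 : 4 * C / p <= Num.sqrt n%:R by near: n; apply: near_sqrtn_ge.
have h2 : 4 * C / p / (beta * eta) <= Num.sqrt n%:R by near: n; apply: near_sqrtn_ge.
have s0 : 0 <= Num.sqrt n%:R :> R by exact: sqrtr_ge0.
have ss : Num.sqrt n%:R * Num.sqrt n%:R = n%:R :> R by rewrite -expr2 sqr_sqrtr.
have C0 : 0 <= C by rewrite /C.
move=> G [hC hI] f [f0 [lam e]].
have /= em := mvec_eigenvector p e.
have nf : nrm f != 0.
  apply: contraNneq f0 => nf; apply/eqP/matrixP => i j; rewrite !mxE.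
  by apply/eqP; rewrite -normr_le0 -nf ler_nrm.
have [hmu|hmu] := ltrP (p * n%:R / 2) `|lam + p|.
  have hCn : C * Num.sqrt n%:R <= p * n%:R / 4.
    have := ler_wpM2r s0 h1; rewrite ss mulrAC ler_pdivrMr//; lra.
  have hK0 : (4 * C / p) ^+ 2 <= K0%:R by rewrite ltW// truncnS_gt.
  by case: (top_eigenvector_sign hp0 n0 C0 hC hCn hmu hK0 nf em) => h; [constructor 1|constructor 2].
constructor 3.
have hn : 4 * C / p <= beta * eta * Num.sqrt n%:R.
  by rewrite -ler_pdivrMl ?mulr_gt0// mulrC.
have hN : Num.sqrt n%:R / eta <= (N n)%:R by rewrite ltW// truncnS_gt.
have hM : 2 * C / eta <= M%:R by rewrite ltW// truncnS_gt.
(* To be applied with c = 1/|f| and c = -1/|f|: the negative set of f is the positive set of -f. *)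
have mass c : c != 0 -> nrm (fun i => c * f i) = 1 ->
    gam * n%:R <= #|[set i | 0 < c * f i]|%:R.
  move=> c0 cf; apply: (bulk_positive_mass (mu := lam + p) hp0 n0 C0 hC hI) => //.
  by move=> i; rewrite mvecZ em -mulr_sumr; ring.
have nf0 : 0 < nrm f by rewrite lt_neqAle eq_sym nf nrm_ge0.
have nfV : 0 < (nrm f)^-1 by rewrite invr_gt0.
split.
  have := mass (nrm f)^-1; rewrite invr_eq0 nrmZ (gtr0_norm nfV) mulVf// => /(_ nf erefl).
  by under eq_finset do rewrite pmulr_rgt0//.
have := mass (- (nrm f)^-1).
rewrite oppr_eq0 invr_eq0 nrmZ normrN (gtr0_norm nfV) mulVf// => /(_ nf erefl).
by under eq_finset do rewrite mulNr oppr_gt0 pmulr_rlt0//.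
Unshelve. all: by end_near.
Qed.

End EigenvectorSigns.

Theorem theorem1p2 (R : realType) (p : R) (hp0 : 0 < p) (hp1 : p < 1) :
  exists K C : nat,
    gnp_aas p (fun (n : nat) (G : sgraph n) =>
      forall f : 'I_n -> R,
        eigenvector (adjacency_mx (adj G)) (\col_v f v) ->
        [/\ forall S : {set {set 'I_n}},
              two_largest (weak_nodal_domains (adj G) f) S ->
              (#|~: finset.cover S| <= K)%N,
            forall S : {set {set 'I_n}},
              two_largest (strong_nodal_domains (adj G) f) S ->
              (#|[set v | f v != 0%R] :\: finset.cover S| <= K)%N,
            (#|weak_nodal_domains (adj G) f| <= C)%N
          & (#|strong_nodal_domains (adj G) f| <= C)%N]).
Proof.
have [K0 [gam [gam0 hsign]]] := gnp_aas_eigenvector_signs hp0 hp1.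
(* Chosen so that 4 eps n is at most both gam n and n/2. As eps n >= 3 for large n, 3m <= 3 eps n +
   3 <= 4 eps n. *)
pose eps := Num.min (gam / 4) (1 / 8).
have eps0 : 0 < eps by rewrite lt_min !divr_gt0.
have [K hedge] := gnp_aas_edge_between hp0 hp1 eps0.
exists (2 * (K + K0))%N, (2 + 2 * 2 ^ (K + K0))%N.
apply: gnp_aas_sub (gnp_aas_and hp0 hp1 hsign hedge) => //.
near=> n.
have n1 : (K + K0 + 3)%:R / eps <= n%:R by near: n; apply: nbhs_infty_ger.
have n2 : (2 * K0)%:R <= n%:R :> R by near: n; apply: nbhs_infty_ger.
rewrite ler_pdivrMr// mulrC !natrD in n1; rewrite natrM in n2.
move=> G [hG edge] f /hG signs.
pose m := (Num.truncn (eps * n%:R)).+1.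
have en0 : 0 <= eps * n%:R by rewrite mulr_ge0// ltW.
have /andP[m1 m2] := truncn_itv en0.
have Km : (K + K0 < m)%N.
  by rewrite ltnS -ltnS -(ltr_nat R) natrD (le_lt_trans _ m2)//; lra.
have edge' (U W : {set 'I_n}) : [disjoint U & W] -> (K <= #|U|)%N -> (m <= #|W|)%N ->
    exists u w, [/\ u \in U, w \in W & adj G u w].
  move=> dUW KU mW; apply: edge => //; apply: le_trans (ltW m2) _.
  by rewrite ler_nat.
have large (X : {set 'I_n}) : gam * n%:R <= #|X|%:R \/ n%:R / 2 <= #|X|%:R :> R ->
    (3 * m <= #|X|)%N.
  move=> hX; rewrite -(ler_nat R) natrM /m -natr1.
  have e4 : 4 * eps * n%:R <= #|X|%:R.
    case: hX => hX; apply: le_trans hX.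
      rewrite ler_wpM2r// -ler_pdivlMl// mulrC ge_min lexx//.
    have : eps <= 1 / 8 by rewrite ge_min lexx orbT.
    by move=> /(ler_wpM2r (ler0n R n)); lra.
  have : 0 <= (K%:R : R) by [].
  have : 0 <= (K0%:R : R) by [].
  lra.
have compl (X Y : {set 'I_n}) : ~: X = Y -> (#|X| <= K0)%N -> (3 * m <= #|Y|)%N.
  move=> <- XK; apply: large; right.
  have := cardsC X; rewrite card_ord => /(congr1 (fun k : nat => k%:R : R)); rewrite natrD.
  by have : #|X|%:R <= K0%:R :> R; [rewrite ler_nat | lra].
have cpos : ~: [set i | f i <= 0] = [set i | 0 < f i] by apply/setP => i; rewrite !inE ltNge.
have cneg : ~: [set i | 0 <= f i] = [set i | f i < 0] by apply/setP => i; rewrite !inE ltNge.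
have dpos : [set i | 0 <= f i] :\: [set i | f i <= 0] = [set i | 0 < f i].
  by apply/setP => i; rewrite !inE -ltNge; case: ltgtP.
have dneg : [set i | f i <= 0] :\: [set i | 0 <= f i] = [set i | f i < 0].
  by apply/setP => i; rewrite !inE -ltNge; case: ltgtP.
have dpos' : [set i | 0 < f i] :\: [set i | f i < 0] = [set i | 0 < f i].
  by apply/setP => i; rewrite !inE; case: ltgtP.
have dneg' : [set i | f i < 0] :\: [set i | 0 < f i] = [set i | f i < 0].
  by apply/setP => i; rewrite !inE; case: ltgtP.
have sub_neg : (#|[set i | (f i < 0)%R]| <= #|[set i | (f i <= 0)%R]|)%N.
  by apply/subset_leq_card/fintype.subsetP => i; rewrite !inE => /ltW.
have sub_pos : (#|[set i | (0 < f i)%R]| <= #|[set i | (0 <= f i)%R]|)%N.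
  by apply/subset_leq_card/fintype.subsetP => i; rewrite !inE => /ltW.
(* The large alternative uses the strict sign set and the bounded one the weak sign set, so the same
   dichotomy serves both kinds of nodal domain. *)
have wp : (3 * m <= #|[set i | (0 < f i)%R]|)%N \/ (#|[set i | (0 <= f i)%R]| <= K0)%N.
  by case: signs => [/(compl _ _ cpos)|h|[/(@or_introl _ _)/large ? _]]; [left|right|left].
have wn : (3 * m <= #|[set i | (f i < 0)%R]|)%N \/ (#|[set i | (f i <= 0)%R]| <= K0)%N.
  by case: signs => [h|/(compl _ _ cneg)|[_ /(@or_introl _ _)/large ?]]; [right|left|left].
have adjC : symmetric (adj G) by move=> x y; rewrite /adj /= finset.setUC.
have [w1 w2] := @nodal_domains_structure _ _ adjC K K0 m
  (fun B => connected_in (adj G) B && [forall x in B, forall y in B, 0 <= f x * f y])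
  [set i | 0 <= f i] [set i | f i <= 0] Km edge'
  (fun B => congr1 _ (weak_sign_sets f B)) ltac:(by rewrite dpos) ltac:(by rewrite dneg).
have [s1 s2] := @nodal_domains_structure _ _ adjC K K0 m
  (fun B => connected_in (adj G) B && [forall x in B, forall y in B, 0 < f x * f y])
  [set i | 0 < f i] [set i | f i < 0] Km edge'
  (fun B => congr1 _ (strong_sign_sets f B))
  ltac:(by rewrite dpos'; case: wp => h; [left|right; apply: leq_trans h])
  ltac:(by rewrite dneg'; case: wn => h; [left|right; apply: leq_trans h]).
split => //.
- move=> S /w1; congr (_ <= _)%N; apply: eq_card => i; rewrite !inE.
  by case: ltgtP; rewrite ?andbT ?orbT.
- move=> S /s1; congr (_ <= _)%N; apply: eq_card => i; rewrite !inE.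
  by case: ltgtP.
Unshelve. all: by end_near.
Qed.
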